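(* Let $m\in\mathbb{N}$, let $\mathfrak{M}\subset(L^2)^m$ be a nonzero doubly invariant subspace and let $\Theta\in(L^\infty)^{m\times m}$ be the matrix that satisfies $M_\Theta=P_{\mathfrak{M}^\perp}$. Then $$\vartheta_-(U|_{\mathfrak{M}})=\operatorname*{ess\,sup}_{z\in\mathbb{T}}\big(\dim\operatorname{Ker}\Theta(z)\big),$$ where $\Theta(z)$ acts on $\mathbb{C}^m$ for a.e. $z\in\mathbb{T}$.
   Context: $\mathbb{T}$ is the unit circle with Lebesgue measure, $L^2=L^2(\mathbb{T})$, $L^\infty=L^\infty(\mathbb{T})$, and $(L^2)^m=L^2(\mathbb{T},\mathbb{C}^m)$. $U$ is multiplication by $z$ on $(L^2)^m$ (a unitary operator). A closed subspace $\mathfrak{M}\subset(L^2)^m$ is doubly invariant if $\mathfrak{M}$ and $\mathfrak{M}^\perp$ are both $U$-invariant; then $U|_{\mathfrak{M}}$ is an invertible operator on $\mathfrak{M}$. $M_\Theta$ denotes multiplication by the matrix function $\Theta$ on $(L^2)^m$, and $P_{\mathfrak{M}^\perp}$ is the orthogonal projection of $(L^2)^m$ onto $\mathfrak{M}^\perp$; for a doubly invariant $\mathfrak{M}$ there is a unique $\Theta\in(L^\infty)^{m\times m}$, with values a.e. orthogonal projection matrices, such that $M_\Theta=P_{\mathfrak{M}^\perp}$. For an invertible bounded operator $T$ on a separable Hilbert space $\mathcal{H}$, the bilateral frame number $\vartheta_-(T)$ is the minimum $k\in\mathbb{N}\cup\{\infty\}$ such that there is a frame for $\mathcal{H}$ formed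 by the union of $k$ bilateral orbits, i.e. a frame of the form $\{T^ng_j:n\in\mathbb{Z},\ j\in J\}$ with $g_j\in\mathcal{H}$ and $\#J=k$ ($J$ countable). A countable indexed family $\{x_i\}$ in $\mathcal{H}$ is a frame if there are $A,B>0$ with $A\|h\|^2\le\sum_i|\langle h,x_i\rangle|^2\le B\|h\|^2$ for all $h\in\mathcal{H}$. *)

(* Defs.v *)
From HB Require Import structures.
From mathcomp Require Import all_boot all_order all_algebra.
From mathcomp Require Import complex.
From mathcomp Require Import all_classical all_reals all_analysis.
From mathcomp Require Import measurable_realfun ess_sup_inf.

Set Implicit Arguments.
Unset Strict Implicit.
Unset Printing Implicit Defensive.

Import Order.TTheory GRing.Theory Num.Theory.
Import numFieldNormedType.Exports.

Local Open Scope classical_set_scope.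
Local Open Scope ring_scope.
Local Open Scope complex_scope.

(* A Hilbert space is given by a set [E] of vectors of [V] and a form [ip],
   linear in its first argument.  The form may be only semidefinite: vectors
   are then representatives, and [x], [y] stand for the same element of the
   Hilbert space iff [hnorm ip (x - y) = 0].  A subspace that is closed in the
   sense below contains all the representatives of its elements. *)
Section Hilbert.
Variables (R : realType) (V : lmodType R[i]) (E : set V) (ip : V -> V -> R[i]).
Implicit Types (H M N : set V) (T P : V -> V).

Definition hnorm (x : V) : R := Num.sqrt (complex.Re (ip x x)).

Definition closed_subspace M :=
  [/\ M `<=` E, M 0,
      forall (a : R[i]) x y, M x -> M y -> M (a *: x + y) &
      forall x, E x ->
        (forall e : R, 0 < e -> exists2 y, M y & hnorm (x - y) < e) -> M x].

Definition orthocompl M : set V := [set x | E x /\ forall y, M y -> ip x y = 0].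

Definition invariant_under T M := forall x, M x -> M (T x).

Definition doubly_invariant T M :=
  [/\ closed_subspace M, invariant_under T M &
      invariant_under T (orthocompl M)].

Definition is_orthoproj N P :=
  forall x, E x -> N (P x) /\ orthocompl N (x - P x).

Definition is_frame H (I : countType) (x : I -> V) :=
  (forall i, H (x i)) /\
  exists A B : R, [/\ 0 < A, 0 < B & forall h, H h ->
    ((A * hnorm h ^+ 2)%:E <=
       \esum_(i in [set: I]) (ComplexField.Normc.normc (ip h (x i)) ^+ 2)%:E
     <= (B * hnorm h ^+ 2)%:E)%E].

(* The power [T ^ n], [n : int], of the restriction of [T] to [H]; for [T]
   bijective from [H] to [H], [pinv_] is the inverse of this restriction. *)
Definition opow H T (n : int) : V -> V :=
  match n with
  | Posz k => iter k T
  | Negz k => iter k.+1 ('pinv_(fun=> 0) H T)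
  end.

Definition bilateral_orbits H T (J : countType) (g : J -> V) : int * J -> V :=
  fun nj => opow H T nj.1 (g nj.2).

(* Infimum of a set of elements of N u {+oo}: it is a minimum as soon as this
   set is nonempty. [counting [set: J]] is the cardinal of [J]. *)
Definition bilateral_frame_number H T : \bar R :=
  ereal_inf [set k | exists (J : countType) (g : J -> V),
    [/\ forall j, H (g j), is_frame H (bilateral_orbits H T g) &
        k = counting [set: J]]].

End Hilbert.

Section Circle.
Variable R : realType.

Definition circle : Type := {z : R[i] | `|z| == 1}.

HB.instance Definition _ := Choice.on circle.

Lemma expi_subproof (t : R) :
  `|cos (2 * pi * t) +i* sin (2 * pi * t)| == 1 :> R[i].
Proof. by rewrite normc_def /= cos2Dsin2 sqrtr1. Qed.

(* t |-> exp (2 i pi t) *)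
Definition expi (t : R) : circle :=
  exist (fun z : R[i] => `|z| == 1) _ (expi_subproof t).

HB.instance Definition _ := isPointed.Build circle (expi 0).

Definition circle_coord (z : circle) : measurableTypeR R * measurableTypeR R :=
  (complex.Re (val z), complex.Im (val z)).

(* The Borel sets of the circle: traces of the Borel sets of the plane. *)
HB.instance Definition _ :=
  Measurable.copy circle (g_sigma_algebra_preimageType circle_coord).

Lemma measurable_expi : measurable_fun [set: measurableTypeR R] expi.
Proof.
have mlin : measurable_fun [set: R] (fun t : R => 2 * pi * t).
  by apply: continuous_measurable_fun; exact: mulrl_continuous.
have mc : measurable_fun [set: measurableTypeR R]
    (fun t : R => (cos (2 * pi * t), sin (2 * pi * t))
       : measurableTypeR R * measurableTypeR R).
  apply: measurable_fun_pair.
    apply: (measurableT_comp _ mlin).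
    by apply: continuous_measurable_fun; exact: continuous_cos.
  apply: (measurableT_comp _ mlin).
  by apply: continuous_measurable_fun; exact: continuous_sin.
by move=> _ _ [B mB <-]; rewrite setTI; exact: mc.
Qed.

HB.instance Definition _ := isMeasurableFun.Build _ _ _ _ expi measurable_expi.

(* Lebesgue measure, normalized to have total mass 1. *)
Definition circle_measure : set circle -> \bar R :=
  pushforward (mrestr (@lebesgue_measure R) (measurable_itv `[0, 1]%R)) expi.

Let mpreimage_expi (A : set circle) : measurable A ->
  measurable (expi @^-1` A : set (measurableTypeR R)).
Proof. by move=> mA; rewrite -[X in measurable X]setTI; exact: measurable_expi. Qed.

Let circle_measure0 : circle_measure set0 = 0%E.
Proof. by rewrite /circle_measure /pushforward preimage_set0 measure0. Qed.

Let circle_measure_ge0 A : (0 <= circle_measure A)%E.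
Proof. by rewrite /circle_measure /pushforward measure_ge0. Qed.

Let circle_measure_sigma_additive : semi_sigma_additive circle_measure.
Proof.
move=> F mF tF mUF; rewrite /circle_measure /pushforward preimage_bigcup.
apply: measure_semi_sigma_additive.
- by move=> n; exact: mpreimage_expi.
- apply/trivIsetP => i j _ _ ij; rewrite -preimage_setI.
  by move/trivIsetP : tF => /(_ _ _ _ _ ij) ->//; rewrite preimage_set0.
- by rewrite -preimage_bigcup; exact: mpreimage_expi.
Qed.

HB.instance Definition _ := isMeasure.Build _ _ _ circle_measure
  circle_measure0 circle_measure_ge0 circle_measure_sigma_additive.

End Circle.

Arguments circle_measure : clear implicits.

Section L2.
Variables (R : realType) (m : nat).
Notation C := R[i].
Notation mu := (circle_measure R).
Implicit Types f g : circle R -> 'cV[C]_m.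

Definition cmeasurable (f : circle R -> C) :=
  measurable_fun setT (fun z => complex.Re (f z) : R) /\
  measurable_fun setT (fun z => complex.Im (f z) : R).

Definition cintegral (f : circle R -> C) : C :=
  Rintegral mu setT (fun z => complex.Re (f z)) +i*
  Rintegral mu setT (fun z => complex.Im (f z)).

(* Functions, not classes: f and g are the same vector of L^2 iff f = g a.e.,
   i.e. iff hnorm L2ip (f - g) = 0. Requiring Borel measurability loses no
   class, as every Lebesgue measurable function is a.e. equal to a Borel one. *)
Definition L2 : set (circle R -> 'cV[C]_m) :=
  [set f | (forall i, cmeasurable (fun z => f z i ord0)) /\
    (\int[mu]_z (\sum_i ComplexField.Normc.normc (f z i ord0) ^+ 2)%:E
       < +oo)%E].

Definition L2ip f g : C :=
  cintegral (fun z => \sum_i f z i ord0 * (g z i ord0)^*).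

Definition Linfty_mx (Theta : circle R -> 'M[C]_m) :=
  forall i j, cmeasurable (fun z => Theta z i j) /\
    (ess_sup mu (fun z => (ComplexField.Normc.normc (Theta z i j))%:E)
       < +oo)%E.

Definition mulz f : circle R -> 'cV[C]_m := fun z => val z *: f z.

Definition mulop (Theta : circle R -> 'M[C]_m) f : circle R -> 'cV[C]_m :=
  fun z => Theta z *m f z.

(* Dimension of the kernel of A acting on column vectors. *)
Definition dim_ker (A : 'M[C]_m) : nat :=
  \dim (lker (linfun (mulmx A : 'cV[C]_m -> 'cV[C]_m))).

End L2.

Arguments L2 {R m}.
Arguments L2ip {R m}.
Arguments mulz {R m}.

(* Main.v *)
Require Import Defs.
From HB Require Import structures.
From mathcomp Require Import all_boot all_order all_algebra.
From mathcomp Require Import finmap complex ring lra.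
From mathcomp Require Import all_classical all_reals all_analysis.
From mathcomp Require Import measurable_realfun ess_sup_inf.

(* Put [P = 1 - Theta].  Fourier coefficients separate integrable functions, so
   [Theta] is a.e. an orthogonal projection and [M] consists of the [f] in L^2
   with [P f = f] a.e.; moreover [dim Ker Theta(z) = tr P(z)].

   If [tr P <= k] a.e., splitting off [k] times the normalized first nonzero
   column of [P(z)] gives measurable fields [w_0, ..., w_(k-1)] with
   [P(z) = sum_j w_j(z) w_j(z)^*].  For [h] in [M], Parseval's identity in
   [L^2(T, C^k)] applied to [(<h, w_j>)_j] says that the orbits of the [w_j]
   form a Parseval frame.

   Conversely, given the [N] generators of a frame, split off from [P(z)]
   successively the projections of their values at [z].  This lowers the trace
   by at most [N], and the columns of the remaining projection are fields in [M]
   orthogonal to all the orbits, hence zero by the lower frame bound: so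
   [tr P <= N] a.e. *)

Set Implicit Arguments.
Unset Strict Implicit.
Unset Printing Implicit Defensive.

Import Order.TTheory GRing.Theory Num.Theory.
Import numFieldNormedType.Exports.
Import ComplexField.

Local Open Scope classical_set_scope.
Local Open Scope ring_scope.
Local Open Scope complex_scope.

(** Vectors are functions and not classes, so the form on [L2] is only semidefinite: decompositions
    are known up to vectors of norm zero, and the closedness of [M] is what absorbs these. The
    obstacle that shapes the pointwise part is measurability: the vectors spanning the range of
    $P(z)$ must depend measurably on $z$. They are therefore given by explicit formulas in the
    entries of $P(z)$, total because $0^{-1}=0$ covers the points where a vector vanishes, and never
    by a choice made at each $z$. The rank enters as a trace: it is a measurable expression in the
    entries, and it drops by exactly one when a nonzero vector of the range is split off. The bridge
    between $L^2$ and single points is multiplication by all powers $z^n$: inner products against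
    $z^n g$ are the Fourier coefficients of the scalar function $\langle f(z),g(z)\rangle$, so their
    vanishing for all $n$ is orthogonality at almost every $z$, and the sum of their squares is an
    integral of pointwise squares. *)

Section ComplexModulus.
Variable R : realType.
Implicit Types a b : R[i].

Lemma normc_sqr a : Normc.normc a ^+ 2 = complex.Re a ^+ 2 + complex.Im a ^+ 2.
Proof. by case: a => x y /=; rewrite sqr_sqrtr // addr_ge0 // sqr_ge0. Qed.

Lemma normc_ge0 a : 0 <= Normc.normc a.
Proof. by case: a => x y /=; rewrite sqrtr_ge0. Qed.

Lemma cReM a b : complex.Re (a * b) =
  complex.Re a * complex.Re b - complex.Im a * complex.Im b.
Proof. by case: a b => [x y] [z t]. Qed.

Lemma cImM a b : complex.Im (a * b) =
  complex.Re a * complex.Im b + complex.Im a * complex.Re b.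
Proof. by case: a b => [x y] [z t]. Qed.

Lemma cReD a b : complex.Re (a + b) = complex.Re a + complex.Re b.
Proof. by case: a b => [x y] [z t]. Qed.

Lemma cImD a b : complex.Im (a + b) = complex.Im a + complex.Im b.
Proof. by case: a b => [x y] [z t]. Qed.

Lemma cReN a : complex.Re (- a) = - complex.Re a.
Proof. by case: a. Qed.

Lemma cImN a : complex.Im (- a) = - complex.Im a.
Proof. by case: a. Qed.

Lemma cReJ a : complex.Re (a^*) = complex.Re a.
Proof. by case: a. Qed.

Lemma cImJ a : complex.Im (a^*) = - complex.Im a.
Proof. by case: a. Qed.

Lemma complex_eqP a b : complex.Re a = complex.Re b -> complex.Im a = complex.Im b -> a = b.
Proof. by case: a b => [x y] [z t] /= -> ->. Qed.

Lemma cRe_sum (I : Type) (s : seq I) (P : pred I) (F : I -> R[i]) :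
  complex.Re (\sum_(i <- s | P i) F i) = \sum_(i <- s | P i) complex.Re (F i).
Proof. by apply: big_morph => //; exact: cReD. Qed.

End ComplexModulus.

Definition ReImE := (cReD, cImD, cReM, cImM, cReN, cImN, cReJ, cImJ).

(** * Projection theorem and Parseval identity for a positive semidefinite form *)

Section SemiHilbert.
Variables (R : realType) (V : lmodType R[i]) (E : set V) (ip : V -> V -> R[i]).
Local Notation hn := (hnorm ip).

(** The laws are asked on [E] only, because [L2] is a set inside the space of all functions and
    integrals need not be linear outside it. Positivity is not strict: a function that vanishes a.e.
    has norm zero. *)
Record semi_inner_product : Prop := SemiInnerProduct {
  sip0 : E 0 ;
  sip_lin : forall a x y, E x -> E y -> E (a *: x + y) ;
  sip_linl : forall a x y z, E x -> E y -> E z ->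
    ip (a *: x + y) z = a * ip x z + ip y z ;
  sipC : forall x y, E x -> E y -> ip x y = (ip y x)^* ;
  sip_ge0 : forall x, E x -> 0 <= complex.Re (ip x x) }.

(* It suffices to test completeness on sequences converging at a fixed
   geometric rate: these are the ones the projection theorem produces. *)
Definition rapidly_complete := forall u : nat -> V, (forall n, E (u n)) ->
  (forall n, hn (u n.+1 - u n) ^+ 2 <= 16^-1 ^+ n) ->
  exists2 x, E x & forall e : R, 0 < e -> exists n : nat,
    forall k, (n <= k)%N -> hn (u k - x) < e.

Hypothesis H : semi_inner_product.

Lemma sipD x y : E x -> E y -> E (x + y).
Proof. by move=> Ex Ey; rewrite -[x]scale1r; exact: (sip_lin H). Qed.

Lemma sipZ a x : E x -> E (a *: x).
Proof. by move=> Ex; rewrite -[X in E X]addr0; apply: (sip_lin H) => //; exact: (sip0 H). Qed.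

Lemma sipB x y : E x -> E y -> E (x - y).
Proof. by move=> Ex Ey; rewrite -scaleN1r addrC; exact: (sip_lin H). Qed.

Lemma ipDl x y z : E x -> E y -> E z -> ip (x + y) z = ip x z + ip y z.
Proof. by move=> Ex Ey Ez; rewrite -[x]scale1r (sip_linl H) // mul1r scale1r. Qed.

Lemma ip0l z : E z -> ip 0 z = 0.
Proof.
move=> Ez; have := ipDl (sip0 H) (sip0 H) Ez; rewrite addr0 => /eqP.
by rewrite -subr_eq0 opprD addNKr oppr_eq0 => /eqP.
Qed.

Lemma ipZl a x z : E x -> E z -> ip (a *: x) z = a * ip x z.
Proof.
move=> Ex Ez; rewrite -[a *: x]addr0 (sip_linl H) //; last exact: (sip0 H).
by rewrite ip0l // addr0.
Qed.

Lemma ipBl x y z : E x -> E y -> E z -> ip (x - y) z = ip x z - ip y z.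
Proof.
move=> Ex Ey Ez; rewrite -scaleN1r addrC (sip_linl H) //.
by rewrite mulN1r addrC.
Qed.

Lemma ipDr x y z : E x -> E y -> E z -> ip z (x + y) = ip z x + ip z y.
Proof.
move=> Ex Ey Ez; rewrite (sipC H) //; last exact: sipD.
rewrite ipDl // (sipC H Ez Ex) (sipC H Ez Ey).
by apply: complex_eqP; rewrite !ReImE //= opprD.
Qed.

Lemma ipZr a x z : E x -> E z -> ip z (a *: x) = a^* * ip z x.
Proof.
move=> Ex Ez; rewrite (sipC H) //; last exact: sipZ.
by rewrite ipZl // (sipC H Ez Ex); apply: complex_eqP; rewrite !ReImE; ring.
Qed.

Lemma ipBr x y z : E x -> E y -> E z -> ip z (x - y) = ip z x - ip z y.
Proof.
move=> Ex Ey Ez; rewrite -scaleN1r ipDr //; last exact: sipZ.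
by rewrite ipZr //; congr (_ + _); apply: complex_eqP; rewrite !ReImE /=; ring.
Qed.

Lemma ip0r z : E z -> ip z 0 = 0.
Proof.
move=> Ez; rewrite (sipC H) //; last exact: (sip0 H).
by rewrite ip0l //; apply: complex_eqP; rewrite !ReImE //= oppr0.
Qed.

Lemma hnormE x : E x -> hn x ^+ 2 = complex.Re (ip x x).
Proof. by move=> Ex; rewrite /hnorm sqr_sqrtr //; exact: (sip_ge0 H). Qed.

Lemma hnorm_ge0 x : 0 <= hn x.
Proof. exact: sqrtr_ge0. Qed.

Lemma hnormDZ a x y : E x -> E y -> hn (x + a *: y) ^+ 2 =
  hn x ^+ 2 + 2 * complex.Re (a^* * ip x y) + Normc.normc a ^+ 2 * hn y ^+ 2.
Proof.
move=> Ex Ey; have Eay := sipZ a Ey.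
rewrite !hnormE //; last exact: sipD.
rewrite ipDl ?ipDr //; try exact: sipD.
rewrite !ipZr // !ipZl // (sipC H Ey Ex) normc_sqr.
by rewrite !ReImE /=; ring.
Qed.

Lemma hnormB x y : E x -> E y -> hn (x - y) ^+ 2 =
  hn x ^+ 2 - 2 * complex.Re (ip x y) + hn y ^+ 2.
Proof.
move=> Ex Ey; rewrite -scaleN1r hnormDZ // normc_sqr !ReImE /=; ring.
Qed.

Lemma hnormD x y : E x -> E y -> hn (x + y) ^+ 2 =
  hn x ^+ 2 + 2 * complex.Re (ip x y) + hn y ^+ 2.
Proof.
move=> Ex Ey; rewrite -[y in LHS]scale1r hnormDZ // normc_sqr !ReImE /=; ring.
Qed.

Lemma hnormZ a x : E x -> hn (a *: x) ^+ 2 = Normc.normc a ^+ 2 * hn x ^+ 2.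
Proof.
move=> Ex; rewrite -[a *: x]add0r hnormDZ //; last exact: (sip0 H).
rewrite (hnormE (sip0 H)) !ip0l //; last exact: (sip0 H).
by rewrite mulr0 /= mulr0 !add0r.
Qed.

(** With [c = ip x y], the squared norm of [x - t c y] is a quadratic polynomial in the real number
    [t], and its minimum at [t = 1 / hn y ^+ 2] gives the bound. If [hn y = 0], which a semidefinite
    form allows for nonzero [y], the polynomial is affine and must be constant. *)
Lemma cauchy_schwarz x y : E x -> E y ->
  Normc.normc (ip x y) ^+ 2 <= hn x ^+ 2 * hn y ^+ 2.
Proof.
move=> Ex Ey; set c := ip x y.
have K t : 0 <= hn x ^+ 2 - 2 * t * Normc.normc c ^+ 2
    + t ^+ 2 * Normc.normc c ^+ 2 * hn y ^+ 2.
  have := sqr_ge0 (hn (x + (- t%:C * c) *: y)); rewrite hnormDZ //.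
  congr (0 <= _).
  by rewrite -/c !normc_sqr !ReImE /=; ring.
have := sqr_ge0 (Normc.normc c); have := sqr_ge0 (hn y); have := sqr_ge0 (hn x).
move: K; move: (hn x ^+ 2) (hn y ^+ 2) (_ c ^+ 2) => p q r K p0 q0 r0.
have [q00|qN0] := eqVneq q 0; last first.
  have := K q^-1; rewrite -(pmulr_rge0 _ (_ : 0 < q)) ?lt_def ?qN0 //.
  have -> : q * (p - 2 * q^-1 * r + q^-1 ^+ 2 * r * q) = p * q - r by field.
  by rewrite subr_ge0.
rewrite q00 mulr0; rewrite leNgt; apply/negP => r1.
(* At this [t] the affine polynomial takes the value -1. *)
have := K ((p + 1) / (2 * r)); rewrite q00 mulr0 addr0.
have -> : 2 * ((p + 1) / (2 * r)) * r = p + 1 by field; rewrite gt_eqF.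
by lra.
Qed.

Lemma hnorm_triangle x y : E x -> E y -> hn (x + y) <= hn x + hn y.
Proof.
move=> Ex Ey; rewrite -(@ler_pXn2r _ 2) ?nnegrE ?addr_ge0 ?hnorm_ge0 //.
rewrite hnormD // sqrrD; suff: complex.Re (ip x y) <= hn x * hn y by lra.
have h0 : 0 <= hn x * hn y by rewrite mulr_ge0 ?hnorm_ge0.
apply: le_trans (ler_norm _) _.
rewrite -(@ler_pXn2r _ 2) ?nnegrE //.
rewrite exprMn real_normK ?num_real //.
apply: le_trans (cauchy_schwarz Ex Ey); rewrite normc_sqr lerDl sqr_ge0 //.
Qed.

Lemma hnorm_sub x y : E x -> E y -> hn (x - y) = hn (y - x).
Proof.
move=> Ex Ey; apply/eqP; rewrite -(@eqrXn2 _ 2) ?hnorm_ge0 //; apply/eqP.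
by rewrite !hnormB // (sipC H Ey Ex) cReJ; ring.
Qed.

Lemma closed_subspaceD M x y : closed_subspace E ip M -> M x -> M y -> M (x + y).
Proof. by case=> _ _ h _ Mx My; rewrite -[x]scale1r; exact: h. Qed.

Lemma closed_subspaceZ M a x : closed_subspace E ip M -> M x -> M (a *: x).
Proof. by case=> _ M0 h _ Mx; rewrite -[_ *: _]addr0; exact: h. Qed.

Lemma orthogonal_decomposition M x : rapidly_complete ->
  closed_subspace E ip M -> E x ->
  exists2 y, M y & orthocompl E ip M (x - y).
Proof.
move=> cplt cM Ex; have [ME M0 Mlin Mcl] := cM.
pose S := [set hn (x - y) ^+ 2 | y in M]; pose d := inf S.
have infS : has_inf S.
  split; first by exists (hn (x - 0) ^+ 2), 0.
  by exists 0 => _ [y My <-]; exact: sqr_ge0.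
have dS z : M z -> d <= hn (x - z) ^+ 2.
  by move=> Mz; apply: ge_inf; [exact: infS.2|exists z].
(* The parallelogram law bounds the squared increment of a minimizing sequence by twice the sum of
   two consecutive slacks; a slack of $16^{-n}/4$ keeps this below the rate $16^{-n}$ of
   [rapidly_complete]. *)
have qpos n : 0 < 16^-1 ^+ n / 4 :> R by rewrite divr_gt0 // exprn_gt0 // invr_gt0.
have : forall n, exists y, M y /\ hn (x - y) ^+ 2 < d + 16^-1 ^+ n / 4.
  move=> n; have [_ [y My <-] ylt] := inf_adherent (qpos n) infS.
  by exists y.
move=> /choice[u Hu].
have Mu n : M (u n) by have [] := Hu n.
have ult n : hn (x - u n) ^+ 2 < d + 16^-1 ^+ n / 4 by have [] := Hu n.
have Eu n : E (u n) by apply: ME.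
have Exu n : E (x - u n) by apply: sipB.
have rap n : hn (u n.+1 - u n) ^+ 2 <= 16^-1 ^+ n.
  have -> : u n.+1 - u n = (x - u n) - (x - u n.+1).
    by rewrite opprB [RHS]addrC addrA subrK.
  have Mm : M (2^-1 *: (u n + u n.+1)).
    by apply: closed_subspaceZ => //; apply: closed_subspaceD.
  have := dS _ Mm.
  have -> : x - 2^-1 *: (u n + u n.+1) = 2^-1 *: ((x - u n) + (x - u n.+1)).
    rewrite addrACA -opprD scalerBr -[x + x]mulr2n -[x *+ 2]scaler_nat scalerA mulVf ?scale1r //.
  have -> : (2^-1 : R[i]) = (2^-1)%:C by rewrite -[X in X^-1](rmorph_nat (real_complex R)) fmorphV.
  rewrite hnormZ; last exact: sipD.
  rewrite hnormB // hnormD // normc_sqr /=.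
  have := ult n; have := ult n.+1; rewrite [16^-1 ^+ n.+1]exprS; have := qpos n.
  by lra.
have [y Ey uy] := cplt u Eu rap.
have My : M y.
  apply: Mcl => // e /uy[n /(_ n (leqnn n)) h]; exists (u n) => //.
  by rewrite hnorm_sub.
exists y => //; split; first exact: sipB.
move=> z Mz; have Ez := ME _ Mz.
set p := hn z ^+ 2; have p0 : 0 <= p by apply: sqr_ge0.
(* A near minimizer is nearly orthogonal to [M]: moving [u n] by [t c z] cannot bring the squared
   distance below [d]. The choice $t=1/(1+p)$ avoids dividing by [p], which may be 0, and still
   gives $2t-t^2p\ge t$. *)
have cn n : Normc.normc (ip (x - u n) z) ^+ 2 <= (1 + p) * (16^-1 ^+ n / 4).
  set c := ip _ _; pose t := (1 + p)^-1.
  have Mz' : M (u n + (t%:C * c) *: z).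
    by apply: closed_subspaceD => //; exact: closed_subspaceZ.
  have := dS _ Mz'; rewrite opprD addrA -scaleNr hnormDZ //.
  rewrite -/c -/p => h.
  have {}h : d <= hn (x - u n) ^+ 2
     - (2 * t - t ^+ 2 * p) * Normc.normc c ^+ 2.
    by apply: le_trans h _; rewrite !normc_sqr !ReImE /=; lra.
  have tp : t * (1 + p) = 1 by rewrite mulVf // gt_eqF //; lra.
  have t0 : 0 < t by rewrite invr_gt0; lra.
  have h2 : t <= 2 * t - t ^+ 2 * p by nra.
  have h3 := ler_wpM2r (sqr_ge0 (Normc.normc c)) h2.
  have h4 : t * Normc.normc c ^+ 2 <= 16^-1 ^+ n / 4 by have := ult n; lra.
  by rewrite -(ler_pM2l t0) [leRHS]mulrA tp mul1r.
(* Passage to the limit [y]: the inner product is split at [u k], with [k] so large that both the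
   slack and the squared distance to [y] are below [e]. *)
have cy (e : R) : 0 < e -> Normc.normc (ip (x - y) z) ^+ 2 <= e * (1 + p) * 4.
  move=> e0; have [n0 un] : exists n, forall k, (n <= k)%N -> hn (u k - y) ^+ 2 < e.
    have [|n hn0] := uy (Num.sqrt e); first by rewrite sqrtr_gt0.
    exists n => k /hn0; rewrite -(@ltr_pXn2r _ 2) ?nnegrE ?hnorm_ge0 ?sqrtr_ge0 //.
    by rewrite [Num.sqrt e ^+ 2]sqr_sqrtr // ltW.
  have [n1 qe] : exists n, forall k, (n <= k)%N -> 16^-1 ^+ k / 4 < e.
    have : (fun n => 16^-1 ^+ n : R) @ \oo --> (0 : R).
      by apply: cvg_expr; rewrite ger0_norm ?invf_lt1 ?ltr1n // invr_ge0.
    move=> /cvgrPdist_lt/(_ _ e0)[n _ hn0]; exists n => k nk.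
    have := hn0 _ nk; rewrite sub0r normrN ger0_norm ?exprn_ge0 ?invr_ge0 //.
    by have := qpos k; lra.
  pose k := maxn n0 n1.
  have h1 := cn k; have h2 := un k (leq_maxl _ _); have h3 := qe k (leq_maxr _ _).
  have Euy : E (u k - y) by apply: sipB.
  have h4 := cauchy_schwarz Euy Ez; rewrite -/p in h4.
  have -> : ip (x - y) z = ip (x - u k) z + ip (u k - y) z.
    by rewrite -ipDl // addrA subrK.
  move: h1 h4; rewrite !normc_sqr !ReImE.
  have := sqr_ge0 (complex.Re (ip (x - u k) z) - complex.Re (ip (u k - y) z)).
  have := sqr_ge0 (complex.Im (ip (x - u k) z) - complex.Im (ip (u k - y) z)).
  have := sqr_ge0 (hn (u k - y)); rewrite !expr2.
  have f1 : (1 + p) * (16^-1 ^+ k / 4) <= (1 + p) * e by rewrite ler_pM2l; lra.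
  have f2 : hn (u k - y) ^+ 2 * p <= e * p by rewrite ler_wpM2r // ltW.
  have ep : 0 <= e * p by rewrite mulr_ge0 // ltW.
  move: f1 f2; rewrite !expr2; lra.
apply: Normc.eq0_normc; apply/eqP; rewrite -sqrf_eq0 eq_le sqr_ge0 andbT.
apply/ler_addgt0Pr => e e0; rewrite add0r.
have := cy (e / (4 * (1 + p))); rewrite divr_gt0 // => [/(_ isT) h|]; last lra.
apply: le_trans h _; rewrite le_eqVlt; apply/orP; left; apply/eqP; field.
by rewrite gt_eqF //; lra.
Qed.

(** The projection [y] of [x] on [M] satisfies only [hnorm ip (x - y) = 0], not [x = y]; closedness
    then gives membership of [x] itself. *)
Lemma orthocomplK M x : rapidly_complete -> closed_subspace E ip M ->
  orthocompl E ip (orthocompl E ip M) x -> M x.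
Proof.
move=> cplt cM [Ex xM]; have [ME M0 Mlin Mcl] := cM.
have [y My [Exy xyM]] := orthogonal_decomposition cplt cM Ex.
have Ey := ME _ My.
have h0 : ip (x - y) (x - y) = 0.
  by rewrite ipBr // (xyM y My) subr0 (sipC H) // xM // rmorph0.
apply: Mcl => // e e0; exists y => //.
suff -> : hn (x - y) = 0 by [].
by apply/eqP; rewrite -sqrf_eq0 hnormE // h0.
Qed.

Lemma hnormZ1 a x : E x -> hn (a *: x) = Normc.normc a * hn x.
Proof.
move=> Ex; apply/eqP; rewrite -(@eqrXn2 _ 2) ?mulr_ge0 ?hnorm_ge0 ?normc_ge0 //.
by rewrite exprMn hnormZ.
Qed.

Lemma ip_orthoC x y : E x -> E y -> ip x y = 0 -> ip y x = 0.
Proof. by move=> Ex Ey xy0; rewrite (sipC H) // xy0 rmorph0. Qed.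

Lemma sip_sum (J : Type) (s : seq J) (F : J -> V) :
  (forall j, E (F j)) -> E (\sum_(j <- s) F j).
Proof.
move=> EF; elim/big_ind : _ => //; [exact: (sip0 H)|exact: sipD].
Qed.

Lemma ip_suml (J : Type) (s : seq J) (F : J -> V) z :
  (forall j, E (F j)) -> E z ->
  ip (\sum_(j <- s) F j) z = \sum_(j <- s) ip (F j) z.
Proof.
move=> EF Ez; elim: s => [|j s IH]; first by rewrite !big_nil ip0l.
by rewrite !big_cons ipDl ?IH //; exact: sip_sum.
Qed.

Section OrthonormalFamily.
Variables (I : choiceType) (e : I -> V).
Hypothesis Ee : forall i, E (e i).
Hypothesis eON : forall i j, ip (e i) (e j) = (i == j)%:R.

Let comb (l : seq (R[i] * I)) := \sum_(p <- l) p.1 *: e p.2.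
Let proj x (s : seq I) := \sum_(i <- s) ip x (e i) *: e i.

Let Ecomb l : E (comb l).
Proof. by apply: sip_sum => j; exact: sipZ. Qed.

Let Eproj x s : E (proj x s).
Proof. by apply: sip_sum => j; exact: sipZ. Qed.

Let ip_proj x s i : uniq s -> i \in s -> ip (proj x s) (e i) = ip x (e i).
Proof.
move=> us si; rewrite ip_suml //; last by move=> j; exact: sipZ.
rewrite (bigD1_seq i) //= ipZl // eON eqxx mulr1 big1 ?addr0 // => j ji.
by rewrite ipZl // eON (negbTE ji) mulr0.
Qed.

Let ip_sub_proj x s i : E x -> uniq s -> i \in s -> ip (x - proj x s) (e i) = 0.
Proof. by move=> Ex us si; rewrite ipBl // ip_proj // subrr. Qed.

Let pythagoras x s : E x -> uniq s ->
  hn x ^+ 2 = hn (x - proj x s) ^+ 2 + \sum_(i <- s) Normc.normc (ip x (e i)) ^+ 2.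
Proof.
move=> Ex us; have Exp : E (x - proj x s) by exact: sipB.
have e0 : ip (x - proj x s) (proj x s) = 0.
  apply: ip_orthoC => //; rewrite ip_suml //; last by move=> j; exact: sipZ.
  rewrite big_seq big1 // => i si; rewrite ipZl //.
  by rewrite (ip_orthoC Exp (Ee i) (ip_sub_proj Ex us si)) mulr0.
have -> : hn x ^+ 2 = hn (x - proj x s + proj x s) ^+ 2 by rewrite subrK.
rewrite hnormD // e0 /= mulr0 addr0; congr (_ + _).
rewrite hnormE // ip_suml //; last by move=> j; exact: sipZ.
rewrite cRe_sum big_seq [RHS]big_seq; apply: eq_bigr => i si.
rewrite ipZl // (sipC H (Ee i)) // ip_proj // normc_sqr !ReImE; ring.
Qed.

Let span_closure : set V :=
  [set y | E y /\ forall r : R, 0 < r -> exists l, hn (y - comb l) < r].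

Let closed_span : closed_subspace E ip span_closure.
Proof.
split.
- by move=> y [].
- split; first exact: (sip0 H).
  move=> r r0; exists [::]; rewrite /comb big_nil subr0.
  suff -> : hn 0 = 0 by [].
  by rewrite /hnorm ip0l ?sqrtr0 //; exact: (sip0 H).
- move=> a y z [Ey Hy] [Ez Hz]; split; first exact: (sip_lin H).
  move=> r r0; have a0 := normc_ge0 a.
  (* The summand 1 keeps the denominator positive when [a = 0]. *)
  have [|l1 h1] := Hy (r / (2 * (1 + Normc.normc a))).
    by apply: divr_gt0 => //; lra.
  have [|l2 h2] := Hz (r / 2); first by lra.
  exists ([seq (a * p.1, p.2) | p <- l1] ++ l2).
  have -> : a *: y + z - comb ([seq (a * p.1, p.2) | p <- l1] ++ l2) =
    a *: (y - comb l1) + (z - comb l2).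
    rewrite /comb big_cat big_map /= opprD addrACA scalerBr; congr (_ - _ + _).
    by rewrite scaler_sumr; apply: eq_bigr => p _; rewrite scalerA.
  apply: le_lt_trans (hnorm_triangle _ _) _; try exact: sipB.
    by apply: sipZ; exact: sipB.
  rewrite hnormZ1; last exact: sipB.
  have : Normc.normc a * hn (y - comb l1) <= r / 2; last by lra.
  apply: (@le_trans _ _ (Normc.normc a * (r / (2 * (1 + Normc.normc a))))).
    by rewrite ler_wpM2l // ltW.
  rewrite mulrCA -[leRHS]mulr1 -!mulrA ler_pM2l // invfM mulrCA ler_pM2l ?invr_gt0 //.
  by rewrite ler_pdivrMr ?mul1r; lra.
- move=> y Ey Hy; split => // r r0.
  have [|z [Ez Hz] yz] := Hy (r / 2); first by lra.
  have [|l zl] := Hz (r / 2); first by lra.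
  exists l; have -> : y - comb l = (y - z) + (z - comb l) by rewrite addrA subrK.
  apply: le_lt_trans (hnorm_triangle _ _) _; try exact: sipB.
  by lra.
Qed.

Lemma bessel x s : E x -> uniq s ->
  \sum_(i <- s) Normc.normc (ip x (e i)) ^+ 2 <= hn x ^+ 2.
Proof. by move=> Ex us; rewrite (pythagoras Ex us) lerDr sqr_ge0. Qed.

(** The remainder of [x] after projection on the closed span is orthogonal to every [e i], hence of
    norm zero by totality, so [x] lies in that closed span. Bessel gives one inequality; finite
    combinations close to [x] give the other. *)
Lemma parseval x : rapidly_complete ->
  (forall y, E y -> (forall i, ip y (e i) = 0) -> hn y = 0) -> E x ->
  (\esum_(i in [set: I]) (Normc.normc (ip x (e i)) ^+ 2)%:E = (hn x ^+ 2)%:E)%E.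
Proof.
move=> cplt tot Ex.
have spanx : span_closure x.
  have [y Wy [Exy xyW]] := orthogonal_decomposition cplt closed_span Ex.
  have h0 : hn (x - y) = 0.
    apply: tot => // i; apply: xyW; split => // r r0; exists [:: (1, i)].
    rewrite /comb big_seq1 scale1r subrr.
    suff -> : hn 0 = 0 by [].
    by rewrite /hnorm ip0l ?sqrtr0 //; exact: (sip0 H).
  have [_ _ _ cl] := closed_span.
  by apply: cl => // r r0; exists y => //; rewrite h0.
apply/eqP; rewrite eq_le; apply/andP; split.
  apply: ge_ereal_sup => _ [F [finF _] <-].
  rewrite fsbig_finite //= sumEFin lee_fin; exact: bessel.
apply/lee_addgt0Pr => r r0.
have [l xl] : exists l, hn (x - comb l) < Num.sqrt r.
  by apply: spanx.2; rewrite sqrtr_gt0.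
pose s := undup [seq p.2 | p <- l]; have us : uniq s by exact: undup_uniq.
(* Among the combinations of the vectors indexed by [s], the projection is the closest to [x], hence
   at least as close as [comb l]. *)
have h1 : hn (x - proj x s) ^+ 2 <= r.
  apply: (@le_trans _ _ (hn (x - comb l) ^+ 2)); last first.
    have := xl; rewrite -(@ltr_pXn2r _ 2) ?nnegrE ?hnorm_ge0 ?sqrtr_ge0 //.
    by rewrite [Num.sqrt r ^+ 2]sqr_sqrtr ?(ltW r0) // => /ltW.
  have -> : x - comb l = (x - proj x s) + (proj x s - comb l).
    by rewrite addrA subrK.
  rewrite [leRHS]hnormD; try exact: sipB.
  suff -> : ip (x - proj x s) (proj x s - comb l) = 0.
    by rewrite mulr0 addr0 lerDl sqr_ge0.
  have Exp : E (x - proj x s) by exact: sipB.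
  have orth i : i \in s -> ip (e i) (x - proj x s) = 0.
    by move=> si; apply: ip_orthoC => //; exact: ip_sub_proj.
  apply: ip_orthoC => //; first exact: sipB.
  rewrite ipBl // !ip_suml //; try by move=> j; exact: sipZ.
  rewrite !big_seq !big1 ?subr0 // => [p pl|i si]; rewrite ipZl // orth ?mulr0 //.
  by rewrite mem_undup; apply/mapP; exists p.
rewrite (pythagoras Ex us) EFinD addeC; apply: leeD; last by rewrite lee_fin.
apply: esum_ge; exists [set` s]; first by split => //; exact: finite_seq.
by rewrite -fsbig_seq // sumEFin.
Qed.

End OrthonormalFamily.

End SemiHilbert.

(** * Complex integration on the circle of total mass 1 *)

Section CircleIntegral.
Variable R : realType.
Local Notation C := R[i].
Local Notation mu := (circle_measure R).
Implicit Types (f g : circle R -> C).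

Lemma circle_measureT : mu [set: circle R] = 1%E.
Proof.
rewrite /circle_measure /pushforward preimage_setT /mrestr setTI.
by rewrite lebesgue_measure_itv /= lte_fin ltr01 oppr0 adde0.
Qed.

HB.instance Definition _ :=
  Measure_isProbability.Build _ _ _ mu circle_measureT.

Lemma integrable_cst_circle (k : R) : mu.-integrable setT (EFin \o cst k).
Proof. exact: finite_measure_integrable_cst. Qed.

(** Inversion is continuous on the open set of nonzero reals, and the single point 0 is handled
    apart. This permits normalizing vector fields that vanish somewhere. *)
Lemma measurable_funV (d : measure_display) (T : measurableType d) (h : T -> R) :
  measurable_fun setT h -> measurable_fun setT (fun t => (h t)^-1).
Proof.
move=> mh; apply: (@measurableT_comp _ _ _ _ _ _ (fun x : R => x^-1)) => //.
rewrite (_ : setT = [set x : R | x != 0] `|` [set 0]); last first.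
  by apply/seteqP; split => // x _ /=; case: (eqVneq x 0) => [->|]; [right|left].
have o : open [set x : R | x != 0] by exact: open_neq.
apply/measurable_funU => //; first exact: open_measurable.
split; last exact: measurable_fun_set1.
apply: open_continuous_measurable_fun => // x; rewrite inE /= => x0.
exact: inv_continuous.
Qed.

Lemma cmeasurable_cst (c : C) : cmeasurable (fun=> c).
Proof. by split; exact: measurable_cst. Qed.

Lemma cmeasurableD f g : cmeasurable f -> cmeasurable g ->
  cmeasurable (fun z => f z + g z).
Proof.
move=> [f1 f2] [g1 g2]; split.
  by under eq_fun do rewrite cReD; exact: measurable_funD.
by under eq_fun do rewrite cImD; exact: measurable_funD.
Qed.

Lemma cmeasurableM f g : cmeasurable f -> cmeasurable g ->
  cmeasurable (fun z => f z * g z).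
Proof.
move=> [f1 f2] [g1 g2]; split.
  under eq_fun do rewrite cReM; apply: measurable_funB; exact: measurable_funM.
under eq_fun do rewrite cImM; apply: measurable_funD; exact: measurable_funM.
Qed.

Lemma cmeasurableJ f : cmeasurable f -> cmeasurable (fun z => (f z)^*).
Proof.
move=> [f1 f2]; split; first by under eq_fun do rewrite cReJ.
by under eq_fun do rewrite cImJ; exact: measurableT_comp.
Qed.

Lemma cmeasurable_realc (h : circle R -> R) :
  measurable_fun setT h -> cmeasurable (fun z => (h z)%:C).
Proof. by move=> mh; split => //; exact: measurable_cst. Qed.

Lemma cmeasurableB f g : cmeasurable f -> cmeasurable g ->
  cmeasurable (fun z => f z - g z).
Proof.
move=> mf mg; under eq_fun do rewrite -[- _]mulN1r.
by apply: cmeasurableD => //; apply: cmeasurableM => //; exact: cmeasurable_cst.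
Qed.

Lemma cmeasurable_sum (I : Type) (s : seq I) (F : I -> circle R -> C) :
  (forall i, cmeasurable (F i)) -> cmeasurable (fun z => \sum_(i <- s) F i z).
Proof.
move=> mF; elim: s => [|i s IH].
  by under eq_fun do rewrite big_nil; exact: cmeasurable_cst.
by under eq_fun do rewrite big_cons; exact: cmeasurableD.
Qed.

Lemma measurable_normc_sqr f : cmeasurable f ->
  measurable_fun setT (fun z => Normc.normc (f z) ^+ 2).
Proof.
move=> [f1 f2]; under eq_fun do rewrite normc_sqr.
by apply: measurable_funD; exact: measurable_funX.
Qed.

Lemma ler_Re_normc (a : C) : `|complex.Re a| <= Normc.normc a.
Proof.
rewrite -(@ler_pXn2r _ 2) ?nnegrE ?normc_ge0 //.
by rewrite real_normK ?num_real // normc_sqr lerDl sqr_ge0.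
Qed.

Lemma ler_Im_normc (a : C) : `|complex.Im a| <= Normc.normc a.
Proof.
rewrite -(@ler_pXn2r _ 2) ?nnegrE ?normc_ge0 //.
by rewrite real_normK ?num_real // normc_sqr lerDr sqr_ge0.
Qed.

Lemma ler_normc_ReIm (a : C) : Normc.normc a <= `|complex.Re a| + `|complex.Im a|.
Proof.
rewrite -(@ler_pXn2r _ 2) ?nnegrE ?normc_ge0 ?addr_ge0 //.
rewrite normc_sqr sqrrD !real_normK ?num_real //.
have : 0 <= `|complex.Re a| * `|complex.Im a| by rewrite mulr_ge0.
by lra.
Qed.

Definition cintegrable f :=
  mu.-integrable setT (EFin \o (fun z => complex.Re (f z))) /\
  mu.-integrable setT (EFin \o (fun z => complex.Im (f z))).

Lemma integrable_measurable_real (h : circle R -> R) :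
  mu.-integrable setT (EFin \o h) -> measurable_fun setT h.
Proof. by move=> /measurable_int /measurable_EFinP. Qed.

Lemma cintegrable_cmeasurable f : cintegrable f -> cmeasurable f.
Proof. by move=> [f1 f2]; split; exact: integrable_measurable_real. Qed.

Lemma integrable_dom (h G : circle R -> R) : measurable_fun setT h ->
  mu.-integrable setT (EFin \o G) -> (forall z, `|h z| <= G z) ->
  mu.-integrable setT (EFin \o h).
Proof.
move=> mh iG hG; apply: (le_integrable _ _ _ iG) => //.
  exact/measurable_EFinP.
by move=> z _ /=; rewrite lee_fin (le_trans (hG z)) // ler_norm.
Qed.

Lemma integrable_realD (h G : circle R -> R) :
  mu.-integrable setT (EFin \o h) -> mu.-integrable setT (EFin \o G) ->
  mu.-integrable setT (EFin \o (fun z => h z + G z)).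
Proof. by move=> ih iG; exact: (integrableD measurableT ih iG). Qed.

Lemma integrable_realZ (k : R) (h : circle R -> R) :
  mu.-integrable setT (EFin \o h) ->
  mu.-integrable setT (EFin \o (fun z => k * h z)).
Proof. by move=> ih; exact: (integrableZl measurableT k ih). Qed.

Lemma integrable_norm (h : circle R -> R) :
  mu.-integrable setT (EFin \o h) ->
  mu.-integrable setT (EFin \o (fun z => `|h z|)).
Proof. by move=> ih; exact: (integrable_abse ih). Qed.

Lemma cintegrable_dom f (G : circle R -> R) : cmeasurable f ->
  mu.-integrable setT (EFin \o G) -> (forall z, Normc.normc (f z) <= G z) ->
  cintegrable f.
Proof.
move=> [f1 f2] iG fG; split; apply: (integrable_dom _ iG) => // z;
  apply: le_trans (fG z); [exact: ler_Re_normc|exact: ler_Im_normc].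
Qed.

Lemma cintegrable_bd f (B : R) : cmeasurable f ->
  (forall z, Normc.normc (f z) <= B) -> cintegrable f.
Proof. by move=> mf; apply: cintegrable_dom => //; exact: integrable_cst_circle. Qed.

Lemma cintegrableMbd f g (B : R) : cintegrable f -> cmeasurable g ->
  (forall z, Normc.normc (g z) <= B) -> cintegrable (fun z => f z * g z).
Proof.
move=> cf mg gB; have mf := cintegrable_cmeasurable cf; case: cf => f1 f2.
apply: (@cintegrable_dom _
  (fun z => B * (`|complex.Re (f z)| + `|complex.Im (f z)|))).
- exact: cmeasurableM.
- by apply: integrable_realZ; apply: integrable_realD; exact: integrable_norm.
- move=> z; rewrite Normc.normcM mulrC.
  apply: ler_pM; rewrite ?normc_ge0 //; exact: ler_normc_ReIm.
Qed.

Lemma cintegrableD f g : cintegrable f -> cintegrable g ->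
  cintegrable (fun z => f z + g z).
Proof.
move=> [f1 f2] [g1 g2]; split.
  by under eq_fun do rewrite cReD; exact: integrable_realD.
by under eq_fun do rewrite cImD; exact: integrable_realD.
Qed.

Lemma cintegrableZ c f : cintegrable f -> cintegrable (fun z => c * f z).
Proof.
move=> cf; under eq_fun do rewrite mulrC.
by apply: cintegrableMbd => //; exact: cmeasurable_cst.
Qed.

Lemma cintegralD f g : cintegrable f -> cintegrable g ->
  cintegral (fun z => f z + g z) = cintegral f + cintegral g.
Proof.
move=> [f1 f2] [g1 g2]; apply: complex_eqP; rewrite ReImE /=.
  by under eq_Rintegral do rewrite cReD; exact: RintegralD.
by under eq_Rintegral do rewrite cImD; exact: RintegralD.
Qed.

Lemma cintegralJ f : cintegrable f ->
  cintegral (fun z => (f z)^*) = (cintegral f)^*.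
Proof.
move=> [f1 f2]; apply: complex_eqP; rewrite ReImE /=.
  by under eq_Rintegral do rewrite cReJ.
by under eq_Rintegral do rewrite cImJ -mulN1r; rewrite RintegralZl // mulN1r.
Qed.

Lemma cintegralZ c f : cintegrable f ->
  cintegral (fun z => c * f z) = c * cintegral f.
Proof.
move=> [f1 f2]; apply: complex_eqP; rewrite ReImE /=.
  under eq_Rintegral do rewrite cReM.
  by rewrite RintegralB ?RintegralZl //; exact: integrable_realZ.
under eq_Rintegral do rewrite cImM.
by rewrite RintegralD ?RintegralZl //; exact: integrable_realZ.
Qed.

Lemma cintegral0 : cintegral (fun _ : circle R => 0 : C) = 0.
Proof. by rewrite /cintegral /= /Rintegral integral0. Qed.

Lemma ae_eq_cintegral f g : cmeasurable f -> cmeasurable g ->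
  {ae mu, forall z, f z = g z} -> cintegral f = cintegral g.
Proof.
move=> [f1 f2] [g1 g2] fg; rewrite /cintegral /Rintegral.
congr (fine _ +i* fine _); apply: ae_eq_integral => //;
  try exact/measurable_EFinP; apply: filterS fg => z /= -> //.
Qed.

End CircleIntegral.

Section GeometricCauchy.
Variable R : realType.

(** The remaining increments sum to at most $2c\,2^{-n}$, so [a n] plus this quantity decreases,
    [a n] minus it increases, and the infimum of the upper sequence is the limit. *)
Lemma geometric_cauchy (a : nat -> R) (c : R) :
  (forall n, `|a n.+1 - a n| <= c * 2^-1 ^+ n) ->
  exists2 l, a @ \oo --> l & forall n, `|a n - l| <= 2 * c * 2^-1 ^+ n.
Proof.
move=> ac; have c0 : 0 <= c by have := ac 0%N; rewrite expr0 mulr1; exact: le_trans.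
pose b n := a n + 2 * c * 2^-1 ^+ n; pose d n := a n - 2 * c * 2^-1 ^+ n.
have E n : 2^-1 ^+ n.+1 = 2^-1 * 2^-1 ^+ n :> R by rewrite exprS.
have bS n : b n.+1 <= b n.
  by have := ac n; rewrite ler_norml => /andP[_]; rewrite /b E; lra.
have dS n : d n <= d n.+1.
  by have := ac n; rewrite ler_norml => /andP[+ _]; rewrite /d E; lra.
have bmono n m : (n <= m)%N -> b m <= b n.
  by move=> /subnK <-; elim: (m - n)%N => // k; apply: le_trans; rewrite addSn.
have dmono n m : (n <= m)%N -> d n <= d m.
  by move=> /subnK <-; elim: (m - n)%N => // k /le_trans; apply; rewrite addSn.
have q0 n : 0 <= 2 * c * 2^-1 ^+ n by rewrite !mulr_ge0 // exprn_ge0 // invr_ge0.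
have db n m : d n <= b m.
  apply: le_trans (dmono _ _ (leq_maxl n m)) _.
  apply: le_trans (bmono _ _ (leq_maxr n m)).
  by have := q0 (maxn n m); rewrite /d /b; lra.
pose l := inf (range b).
have infb : has_inf (range b).
  by split; [exists (b 0%N), 0%N|exists (d 0%N) => _ [n _ <-]; exact: db].
have al n : `|a n - l| <= 2 * c * 2^-1 ^+ n.
  have h1 : l <= b n by apply: ge_inf; [exact: infb.2|exists n].
  have h2 : d n <= l by apply: lb_le_inf; [exact: infb.1|move=> _ [m _ <-]].
  by rewrite ler_norml; move: h1 h2; rewrite /b /d => h1 h2; apply/andP; split; lra.
exists l => //.
have q : (fun n => 2 * c * 2^-1 ^+ n) @ \oo --> (0 : R).
  rewrite -[X in _ --> X](mulr0 (2 * c)); apply: cvgM; first exact: cvg_cst.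
  by apply: cvg_expr; rewrite ger0_norm ?invf_lt1 ?ltr1n // invr_ge0.
apply/cvgrPdist_le => e e0; move/cvgrPdist_le : q => /(_ e e0).
apply: filterS => n; rewrite sub0r normrN ger0_norm // => h.
by rewrite distrC; exact: le_trans (al n) h.
Qed.

End GeometricCauchy.

(** * The semi-inner product of vector-valued $L^2$ *)

Section L2Hilbert.
Variables (R : realType) (m : nat).
Local Notation C := R[i].
Local Notation mu := (circle_measure R).
Local Notation V := (circle R -> 'cV[C]_m).
Implicit Types (f g : V) (v w : 'cV[C]_m).

Definition cvnorm2 v : R := \sum_i Normc.normc (v i ord0) ^+ 2.

Definition cvdot v w : C := \sum_i v i ord0 * (w i ord0)^*.

Lemma cvnorm2_ge0 v : 0 <= cvnorm2 v.
Proof. by apply: sumr_ge0 => i _; exact: sqr_ge0. Qed.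

Lemma cvnorm2E v : cvnorm2 v = complex.Re (cvdot v v).
Proof.
by rewrite /cvdot cRe_sum; apply: eq_bigr => i _; rewrite normc_sqr !ReImE; ring.
Qed.

Lemma cvnorm2_eq0 v : cvnorm2 v = 0 -> v = 0.
Proof.
move=> /eqP; rewrite psumr_eq0 => [/allP h|i _]; last exact: sqr_ge0.
apply/colP => i; rewrite mxE; apply: Normc.eq0_normc.
by apply/eqP; rewrite -sqrf_eq0; apply: h; rewrite mem_index_enum.
Qed.

Lemma cvnorm20 : cvnorm2 0 = 0.
Proof. by rewrite /cvnorm2 big1 // => i _; rewrite mxE Normc.normc0 expr0n. Qed.

Lemma cvnorm2_lin a v w :
  cvnorm2 (a *: v + w) <= 2 * Normc.normc a ^+ 2 * cvnorm2 v + 2 * cvnorm2 w.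
Proof.
rewrite /cvnorm2 !mulr_sumr -big_split /=; apply: ler_sum => i _.
rewrite !mxE -mulrA -exprMn -Normc.normcM !normc_sqr !cReD !cImD.
move: (a * _) (w i ord0) => [x y] [z t] /=.
have := sqr_ge0 (x - z); have := sqr_ge0 (y - t); rewrite !expr2; lra.
Qed.

Lemma cvdot_le v w : Normc.normc (cvdot v w) <= cvnorm2 v + cvnorm2 w.
Proof.
rewrite /cvdot /cvnorm2 -big_split /=.
elim/big_ind2 : _ => [|a x b y ax b_y|i _]; first by rewrite Normc.normc0.
  apply: le_trans (lerD ax b_y).
  exact: (le_normcD (x : Rcomplex R) (y : Rcomplex R)).
rewrite Normc.normcM.
have -> : Normc.normc ((w i ord0)^*) = Normc.normc (w i ord0).
  by case: (w i ord0) => x y /=; rewrite sqrrN.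
have := sqr_ge0 (Normc.normc (v i ord0) - Normc.normc (w i ord0)).
have := sqr_ge0 (Normc.normc (v i ord0)); have := sqr_ge0 (Normc.normc (w i ord0)).
by rewrite !expr2; lra.
Qed.

Lemma cvdotJ v w : cvdot v w = (cvdot w v)^*.
Proof.
rewrite /cvdot rmorph_sum; apply: eq_bigr => i _.
by apply: complex_eqP; rewrite !ReImE; ring.
Qed.

Definition cvmeasurable f := forall i, cmeasurable (fun z => f z i ord0).

Lemma cvmeasurable_lin (a : circle R -> C) f g : cmeasurable a ->
  cvmeasurable f -> cvmeasurable g -> cvmeasurable (fun z => a z *: f z + g z).
Proof.
move=> ma mf mg i; under eq_fun do rewrite !mxE.
by apply: cmeasurableD => //; exact: cmeasurableM.
Qed.

Lemma measurable_cvnorm2 f : cvmeasurable f ->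
  measurable_fun setT (fun z => cvnorm2 (f z)).
Proof. by move=> mf; apply: measurable_sum => i; exact: measurable_normc_sqr. Qed.

Lemma cmeasurable_cvdot f g : cvmeasurable f -> cvmeasurable g ->
  cmeasurable (fun z => cvdot (f z) (g z)).
Proof.
by move=> mf mg; apply: cmeasurable_sum => i; apply: cmeasurableM => //; exact: cmeasurableJ.
Qed.

Lemma L2E f : L2 f <-> cvmeasurable f /\
  mu.-integrable setT (EFin \o (fun z => cvnorm2 (f z))).
Proof.
have K : (\int[mu]_z `| (cvnorm2 (f z))%:E | = \int[mu]_z (cvnorm2 (f z))%:E)%E.
  by apply: eq_integral => z _; rewrite gee0_abs // lee_fin cvnorm2_ge0.
split=> -[mf If]; split => //.
  apply/integrableP; split; last by rewrite K.
  by apply/measurable_EFinP; exact: measurable_cvnorm2.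
by move/integrableP : If => [_]; rewrite K.
Qed.

Lemma L2_dom f (G : circle R -> R) : cvmeasurable f ->
  mu.-integrable setT (EFin \o G) -> (forall z, cvnorm2 (f z) <= G z) -> L2 f.
Proof.
move=> mf iG fG; apply/L2E; split => //; apply: integrable_dom iG _ => //.
  exact: measurable_cvnorm2.
by move=> z; rewrite ger0_norm // cvnorm2_ge0.
Qed.

Lemma L2_bd f (B : R) : cvmeasurable f -> (forall z, cvnorm2 (f z) <= B) -> L2 f.
Proof. by move=> mf; apply: L2_dom => //; exact: integrable_cst_circle. Qed.

Lemma L2_cvmeasurable f : L2 f -> cvmeasurable f.
Proof. by move=> /L2E[]. Qed.

Lemma cintegrable_cvdot f g : L2 f -> L2 g ->
  cintegrable (fun z => cvdot (f z) (g z)).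
Proof.
move=> /L2E[mf fi] /L2E[mg gi].
apply: (@cintegrable_dom _ _ (fun z => cvnorm2 (f z) + cvnorm2 (g z))).
- exact: cmeasurable_cvdot.
- exact: integrable_realD.
- by move=> z; exact: cvdot_le.
Qed.

Lemma L2_hnormE f : L2 f -> complex.Re (L2ip f f) = Rintegral mu setT (fun z => cvnorm2 (f z)).
Proof. by move=> Lf /=; apply: eq_Rintegral => z _; rewrite cvnorm2E. Qed.

Lemma L2_lin a f g : L2 f -> L2 g -> L2 (a *: f + g).
Proof.
move=> /L2E[mf fi] /L2E[mg gi].
apply: (@L2_dom _ (fun z => 2 * Normc.normc a ^+ 2 * cvnorm2 (f z) + 2 * cvnorm2 (g z))).
- by apply: cvmeasurable_lin => //; exact: cmeasurable_cst.
- by apply: integrable_realD; exact: integrable_realZ.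
- by move=> z; exact: cvnorm2_lin.
Qed.

Lemma L2_sip : @semi_inner_product R V L2 L2ip.
Proof.
split.
- apply: (@L2_bd _ 0) => [i|z]; last by rewrite cvnorm20.
  by under eq_fun do rewrite mxE; exact: cmeasurable_cst.
- exact: L2_lin.
- move=> a f g h Lf Lg Lh; rewrite /L2ip -cintegralZ; last exact: cintegrable_cvdot.
  rewrite -cintegralD; last 2 first.
  + by apply: cintegrableZ; exact: cintegrable_cvdot.
  + exact: cintegrable_cvdot.
  congr cintegral; apply/funext => z; rewrite mulr_sumr -big_split /=.
  by apply: eq_bigr => i _; rewrite !mxE mulrDl mulrA.
- move=> f g Lf Lg; rewrite /L2ip -cintegralJ; last exact: cintegrable_cvdot.
  by congr cintegral; apply/funext => z; exact: cvdotJ.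
- move=> f Lf; rewrite L2_hnormE //; apply: Rintegral_ge0 => z _; exact: cvnorm2_ge0.
Qed.

Lemma L2_hnorm_sqr f : L2 f ->
  hnorm L2ip f ^+ 2 = Rintegral mu setT (fun z => cvnorm2 (f z)).
Proof. by move=> Lf; rewrite (hnormE L2_sip) // L2_hnormE. Qed.

Lemma hnorm_eq0 f : L2 f -> hnorm L2ip f = 0 <-> {ae mu, forall z, f z = 0}.
Proof.
move=> Lf; have [mf fi] := (L2E f).1 Lf.
have mn := measurable_cvnorm2 mf.
have K := ae_eq_integral_abs mu measurableT (f := fun z => (cvnorm2 (f z))%:E)
  ((measurable_EFinP _ _).2 mn).
have K2 : (\int[mu]_z `| (cvnorm2 (f z))%:E | = (hnorm L2ip f ^+ 2)%:E)%E.
  rewrite L2_hnorm_sqr // /Rintegral fineK; last exact: integrable_fin_num.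
  by apply: eq_integral => z _; rewrite gee0_abs // lee_fin cvnorm2_ge0.
split => [f0|f0].
  have /K : (\int[mu]_z `| (cvnorm2 (f z))%:E | = 0)%E by rewrite K2 f0 expr0n.
  by apply: filterS => z /(_ I) [] /cvnorm2_eq0.
have /K : ae_eq mu setT (fun z => (cvnorm2 (f z))%:E) (cst 0%E).
  by apply: filterS f0 => z -> _; rewrite cvnorm20.
by rewrite K2 => -[] /eqP; rewrite sqrf_eq0 => /eqP.
Qed.

End L2Hilbert.

(** * Completeness of $L^2$ (Riesz-Fischer) *)

Section RieszFischer.
Variables (R : realType) (m : nat).
Local Notation C := R[i].
Local Notation mu := (circle_measure R).
Local Notation V := (circle R -> 'cV[C]_m).

Lemma cvnorm2_coord (v : 'cV[C]_m) i :
  complex.Re (v i ord0) ^+ 2 + complex.Im (v i ord0) ^+ 2 <= cvnorm2 v.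
Proof.
rewrite -normc_sqr /cvnorm2 (bigD1 i) //= lerDl.
by apply: sumr_ge0 => j _; exact: sqr_ge0.
Qed.

Lemma ler_abs_sqrt (x y h : R) n : x ^+ 2 + y ^+ 2 <= h * 4^-1 ^+ n ->
  0 <= h -> `|x| <= Num.sqrt h * 2^-1 ^+ n /\ `|y| <= Num.sqrt h * 2^-1 ^+ n.
Proof.
move=> xyh h0; have q : 2^-1 ^+ n * 2^-1 ^+ n = 4^-1 ^+ n :> R.
  by rewrite -exprMn -invfM -natrM.
have p0 : 0 <= Num.sqrt h * 2^-1 ^+ n by rewrite mulr_ge0 ?sqrtr_ge0 ?exprn_ge0 // invr_ge0.
by split; rewrite -(@ler_pXn2r _ 2) ?nnegrE // real_normK ?num_real // exprMn
  sqr_sqrtr // [X in _ <= _ * X]expr2 q; apply: le_trans xyh;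
  rewrite ?lerDl ?lerDr sqr_ge0.
Qed.

(** Each real or imaginary part has increments at most $\sqrt h\,2^{-n}$, hence squared error at
    most $4h\,4^{-n}$; the two parts of the [m] coordinates make up the factor [8 * m]. *)
Lemma cv_geometric_cauchy (v : nat -> 'cV[C]_m) (h : R) : 0 <= h ->
  (forall n, cvnorm2 (v n.+1 - v n) <= h * 4^-1 ^+ n) ->
  exists x : 'cV[C]_m,
    [/\ forall i, (fun n => complex.Re (v n i ord0)) @ \oo --> complex.Re (x i ord0),
        forall i, (fun n => complex.Im (v n i ord0)) @ \oo --> complex.Im (x i ord0) &
        forall n, cvnorm2 (v n - x) <= 8 * m%:R * h * 4^-1 ^+ n].
Proof.
move=> h0 vh.
have K i n : `|complex.Re (v n.+1 i ord0) - complex.Re (v n i ord0)| <= Num.sqrt h * 2^-1 ^+ n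
   /\ `|complex.Im (v n.+1 i ord0) - complex.Im (v n i ord0)| <= Num.sqrt h * 2^-1 ^+ n.
  apply: ler_abs_sqrt => //; apply: le_trans (vh n).
  by apply: le_trans (cvnorm2_coord _ i); rewrite !mxE !ReImE.
have /choice[a Ha] : forall i, exists l : R, (fun n => complex.Re (v n i ord0)) @ \oo --> l /\
    forall n, `|complex.Re (v n i ord0) - l| <= 2 * Num.sqrt h * 2^-1 ^+ n.
  by move=> i; have [l l1 l2] := geometric_cauchy (fun n => (K i n).1); exists l.
have /choice[b Hb] : forall i, exists l : R, (fun n => complex.Im (v n i ord0)) @ \oo --> l /\
    forall n, `|complex.Im (v n i ord0) - l| <= 2 * Num.sqrt h * 2^-1 ^+ n.
  by move=> i; have [l l1 l2] := geometric_cauchy (fun n => (K i n).2); exists l.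
exists (\col_i (a i +i* b i)); split.
- by move=> i; rewrite mxE; exact: (Ha i).1.
- by move=> i; rewrite mxE; exact: (Hb i).1.
move=> n; rewrite /cvnorm2.
have -> : 8 * m%:R * h * 4^-1 ^+ n = \sum_(i < m) (8 * h * 4^-1 ^+ n).
  by rewrite sumr_const card_ord -mulr_natl; ring.
apply: ler_sum => i _; rewrite !mxE normc_sqr !ReImE /=.
have sq (x y : R) : `|x| <= y -> x ^+ 2 <= y ^+ 2.
  move=> xy; rewrite -[x ^+ 2]real_normK ?num_real // ler_pXn2r ?nnegrE //.
  exact: le_trans xy.
have := sq _ _ ((Ha i).2 n); have := sq _ _ ((Hb i).2 n).
rewrite !exprMn sqr_sqrtr //.
have -> : (2^-1 ^+ n) ^+ 2 = 4^-1 ^+ n :> R.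
  by rewrite expr2 -exprMn -invfM -natrM.
by lra.
Qed.

Lemma L2_rapidly_complete : rapidly_complete L2 (@L2ip R m).
Proof.
move=> u Lu uc.
pose D n z := cvnorm2 (u n.+1 z - u n z).
have D0 n z : 0 <= D n z by exact: cvnorm2_ge0.
have LD n : L2 (u n.+1 - u n) by exact: (sipB (L2_sip R m)).
have mD n : measurable_fun setT (D n).
  by have /L2E[/measurable_cvnorm2] := LD n.
have iD n : mu.-integrable setT (EFin \o D n) by have /L2E[] := LD n.
have ID n : (\int[mu]_z (D n z)%:E <= (16^-1 ^+ n)%:E)%E.
  have -> : (\int[mu]_z (D n z)%:E)%E = (Rintegral mu setT (D n))%:E.
    by rewrite /Rintegral fineK //; exact: (integrable_fin_num measurableT (iD n)).
  by rewrite lee_fin -(L2_hnorm_sqr (LD n)).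
(* The weights $4^n$ keep the integrals summable, being bounded by $4^n16^{-n}$, and wherever the
   sum [H] is finite they force the pointwise decay [D n z <= h z * 4^-1 ^+ n]. *)
pose F n z := (4 ^+ n * D n z)%:E.
have F0 n z : (0 <= F n z)%E by rewrite lee_fin mulr_ge0 // exprn_ge0.
have mF n : measurable_fun setT (F n).
  by apply/measurable_EFinP; apply: measurable_funM => //; exact: measurable_cst.
pose H z := (\sum_(0 <= n <oo) F n z)%E.
have H0 z : (0 <= H z)%E by apply: nneseries_ge0 => n _ _; exact: F0.
have mH : measurable_fun setT H.
  by apply: ge0_emeasurable_sum => // n z _ _; exact: F0.
have IH : (\int[mu]_z H z < +oo)%E.
  rewrite integral_nneseries //.
  apply: (@le_lt_trans _ _ (\sum_(0 <= n <oo) (4^-1 ^+ n)%:E)%E).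
    apply: lee_nneseries => [n _ _|n _]; first exact: integral_ge0.
    rewrite /F; under eq_integral do rewrite EFinM.
    rewrite ge0_integralZl //; last 2 first.
    - exact/measurable_EFinP.
    - by move=> z _; rewrite lee_fin.
    apply: (@le_trans _ _ ((4 ^+ n)%:E * (16^-1 ^+ n)%:E)%E).
      by rewrite lee_pmul2l // lte_fin exprn_gt0.
    by rewrite -EFinM lee_fin -exprMn (_ : 4 * 16^-1 = 4^-1 :> R) //; field.
  have /(_ 4^-1) := @cvg_geometric_series R 1.
  rewrite ger0_norm ?invr_ge0 // invf_lt1 // ltr1n // => /(_ isT) cv.
  have -> : (\sum_(0 <= n <oo) (4^-1 ^+ n : R)%:E)%E = (1 / (1 - 4^-1))%:E; last exact: ltry.
  apply/cvg_lim => //.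
  apply: cvg_EFin; first by near=> n; rewrite sumEFin.
  apply: cvg_trans cv; apply: near_eq_cvg; near=> n.
  rewrite /= sumEFin /= /series /geometric /=.
  by apply: eq_bigr => k _; rewrite mul1r.
have iH : mu.-integrable setT H.
  apply/integrableP; split => //.
  by under eq_integral do rewrite gee0_abs //.
have aeH := integrable_ae measurableT iH.
pose S z := (H z < +oo)%E.
pose h z := fine (H z).
have h0 z : 0 <= h z by exact: fine_ge0.
have mh : measurable_fun setT h by exact: measurableT_comp.
have ih : mu.-integrable setT (EFin \o h).
  apply: (le_integrable measurableT _ _ iH); first exact/measurable_EFinP.
  move=> z _ /=; rewrite gee0_abs // ger0_norm //.
  by rewrite /h; have := H0 z; case: (H z) => [r| |] //= _; exact: leey.
have DS n z : S z -> D n z <= h z * 4^-1 ^+ n.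
  move=> Sz; have : (F n z <= H z)%E.
    have := @nneseries_lim_ge R (F ^~ z) xpredT 0%N n.+1 (fun k _ _ => F0 k z).
    by apply: le_trans; rewrite big_nat_recr //= leeDr // sume_ge0.
  have -> : H z = (h z)%:E by rewrite /h fineK // ge0_fin_numE.
  rewrite /F lee_fin exprVn -ler_pdivlMl ?invr_gt0 ?exprn_gt0 // ?invrK mulrC.
  by rewrite ler_pdivlMr ?exprn_gt0 // mulrC.
have mS : measurable_fun setT S.
  apply: (measurable_fun_bool true); rewrite setTI.
  rewrite (_ : S @^-1` [set true] = [set: circle R] `&` [set z | (H z < +oo)%E]).
    by apply: measurable_lte => //; exact: measurable_cst.
  by rewrite setTI.
(* Replacing [u n] by 0 off the set of finiteness makes the sequence converge at every point, so the
   limit is measurable and not merely defined a.e.; norms are unchanged since the complement of [S]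
   is null. *)
pose v n z := if S z then u n z else 0.
have mv n : cvmeasurable (v n).
  move=> i; have mu_ := L2_cvmeasurable (Lu n) i; case: mu_ => m1 m2.
  rewrite /v; split.
    rewrite (_ : (fun z => _) = (fun z => if S z then complex.Re (u n z i ord0) else 0)).
      by apply: measurable_fun_ifT => //; exact: measurable_cst.
    by apply/funext => z; case: (S z) => //; rewrite mxE.
  rewrite (_ : (fun z => _) = (fun z => if S z then complex.Im (u n z i ord0) else 0)).
    by apply: measurable_fun_ifT => //; exact: measurable_cst.
  by apply/funext => z; case: (S z) => //; rewrite mxE.
have Lv n : L2 (v n).
  have /L2E[_ iu] := Lu n; apply: L2_dom iu _ => //.
  by move=> z; rewrite /v; case: (S z) => //; rewrite cvnorm20 cvnorm2_ge0.
have /choice[x Hx] : forall z, exists x : 'cV[C]_m,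
    [/\ forall i, (fun n => complex.Re (v n z i ord0)) @ \oo --> complex.Re (x i ord0),
        forall i, (fun n => complex.Im (v n z i ord0)) @ \oo --> complex.Im (x i ord0) &
        forall n, cvnorm2 (v n z - x) <= 8 * m%:R * h z * 4^-1 ^+ n].
  move=> z; apply: cv_geometric_cauchy => // n; rewrite /v.
  have := DS n z; case: (S z) => [/(_ isT)//|_].
  by rewrite subrr cvnorm20 mulr_ge0 // exprn_ge0 // invr_ge0.
have mx : cvmeasurable x.
  move=> i; split.
    apply: (@measurable_fun_cvg _ _ _ _ (fun n z => complex.Re (v n z i ord0))).
      by move=> n; exact: (mv n i).1.
    by move=> z _; have [+ _ _] := Hx z; exact.
  apply: (@measurable_fun_cvg _ _ _ _ (fun n z => complex.Im (v n z i ord0))).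
    by move=> n; exact: (mv n i).2.
  by move=> z _; have [_ + _] := Hx z; exact.
have Lvx n : L2 (v n - x).
  apply: (@L2_dom _ _ _ (fun z => (8 * m%:R * 4^-1 ^+ n) * h z)).
  - rewrite (_ : v n - x = fun z => (-1) *: x z + v n z).
      by apply: cvmeasurable_lin => //; exact: cmeasurable_cst.
    by apply/funext => z; rewrite scaleN1r addrC.
  - exact: integrable_realZ.
  - by move=> z; have [_ _ /(_ n)] := Hx z; rewrite mulrAC.
have Lx : L2 x.
  (* Square integrability of the limit is inherited from [v 0], the difference being dominated by a
     multiple of [h]. *)
  rewrite (_ : x = v 0%N - (v 0%N - x)); first exact: (sipB (L2_sip R m)).
  by rewrite opprB addrC subrK.
exists x => // e e0.
pose K := 8 * m%:R * Rintegral mu setT h.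
have hK n : hnorm L2ip (u n - x) ^+ 2 <= K * 4^-1 ^+ n.
  have -> : hnorm L2ip (u n - x) = hnorm L2ip (v n - x).
    rewrite /hnorm; congr (Num.sqrt _).
    have Lux : L2 (u n - x) by exact: (sipB (L2_sip R m)).
    rewrite !L2_hnormE // /Rintegral; congr fine.
    have [mux _] := (L2E _).1 Lux; have [mvx _] := (L2E _).1 (Lvx n).
    apply: ae_eq_integral => //; try by apply/measurable_EFinP; exact: measurable_cvnorm2.
    apply: filterS aeH => z /(_ I) Hz _.
    have vu : v n z = u n z by rewrite /v /S; move: Hz; rewrite ge0_fin_numE // => ->.
    by have -> : (v n - x) z = (u n - x) z by rewrite -[LHS]/(v n z - x z) vu.
  rewrite L2_hnorm_sqr // /K mulrAC -RintegralZl //.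
  apply: le_Rintegral => //.
  - by have /L2E[] := Lvx n.
  - exact: integrable_realZ.
  - by move=> z _; have [_ _ /(_ n)] := Hx z; rewrite mulrAC.
have : (fun n => K * 4^-1 ^+ n) @ \oo --> (0 : R).
  rewrite -[X in _ --> X](mulr0 K); apply: cvgM; first exact: cvg_cst.
  by apply: cvg_expr; rewrite ger0_norm ?invf_lt1 ?ltr1n // invr_ge0.
move/cvgrPdist_lt => /(_ (e ^+ 2)); rewrite exprn_gt0 // => /(_ isT)[N _ HN].
exists N => k Nk; rewrite -(@ltr_pXn2r _ 2) ?nnegrE ?hnorm_ge0 ?(ltW e0) //.
apply: le_lt_trans (hK k) _; apply: le_lt_trans (HN _ Nk).
by rewrite sub0r normrN ler_norm.
Unshelve. all: by end_near.
Qed.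

End RieszFischer.

(** * Polynomial approximation of the sign function *)

Section SignIteration.
Variable R : realType.
Implicit Types x p : R.

(* The iterates of this polynomial converge to the sign function on [[-1, 1]]. *)
Definition sgstep p : R := p * (3 - p ^+ 2) / 2.

Lemma sgstepN p : sgstep (- p) = - sgstep p.
Proof. by rewrite /sgstep sqrrN; ring. Qed.

Lemma iter_sgstepN n p : iter n sgstep (- p) = - iter n sgstep p.
Proof. by elim: n => //= n ->; exact: sgstepN. Qed.

(** The distances to the two endpoints factor: $1-s(p)=(1-p)^2(2+p)/2$ and $1+s(p)=(1+p)^2(2-p)/2$,
    with $s$ for [sgstep]. *)
Lemma sgstep_bound p : `|p| <= 1 -> `|sgstep p| <= 1.
Proof.
rewrite !ler_norml /sgstep => /andP[p1 p2]; apply/andP; split.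
  have : 0 <= (1 + p) ^+ 2 * (2 - p) by rewrite mulr_ge0 ?sqr_ge0; lra.
  by rewrite !expr2; lra.
have : 0 <= (1 - p) ^+ 2 * (2 + p) by rewrite mulr_ge0 ?sqr_ge0; lra.
by rewrite !expr2; lra.
Qed.

(** On $[x,1]$ the step increases, and $1-s(p)=(1-p)(1-p(1+p)/2)$; as $p\ge x$, the last factor is
    at most $1-x/2$, so the distance to 1 contracts geometrically. *)
Lemma iter_sgstep_pos n x : 0 < x <= 1 ->
  x <= iter n sgstep x <= 1 /\ 1 - iter n sgstep x <= (1 - x / 2) ^+ n.
Proof.
move=> /andP[x0 x1]; elim: n => [|n [/andP[a b] c]] /=.
  by rewrite lexx x1 expr0; split => //; lra.
move: a b c; move: (iter n sgstep x) => p xp p1 c.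
have d : p <= sgstep p.
  have : 0 <= p * (1 - p) * (1 + p) by rewrite !mulr_ge0 //; lra.
  by rewrite /sgstep expr2; lra.
have e : 1 - sgstep p <= (1 - p) * (1 - x / 2).
  have h1 : 0 <= (1 - p) * (p - x) by rewrite mulr_ge0 //; lra.
  have h2 : 0 <= (1 - p) * (p * p) by rewrite mulr_ge0 ?mulr_ge0 //; lra.
  by rewrite /sgstep expr2; lra.
have pb : `|p| <= 1 by rewrite ger0_norm //; lra.
split; first by have := sgstep_bound pb; rewrite ler_norml => /andP[_ ->]; lra.
rewrite exprS mulrC; apply: le_trans e _; rewrite ler_wpM2r //; lra.
Qed.

Lemma iter_sgstep_cvg x : `|x| <= 1 ->
  (fun n => iter n sgstep x) @ \oo --> Num.sg x.
Proof.
have pos y : 0 < y <= 1 -> (fun n => iter n sgstep y) @ \oo --> (1 : R).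
  move=> y01; have /andP[y0 y1] := y01.
  have : (fun n => (1 - y / 2) ^+ n) @ \oo --> (0 : R).
    by apply: cvg_expr; rewrite ger0_norm; lra.
  move/cvgrPdist_le => h; apply/cvgrPdist_le => e e0.
  apply: filterS (h _ e0) => n; rewrite sub0r normrN.
  have [/andP[_ a] b] := iter_sgstep_pos n y01.
  by rewrite !ger0_norm ?exprn_ge0 //; try lra; exact: le_trans.
rewrite ler_norml => /andP[x1 x2].
case: (ltrgt0P x) => [x0|x0|->].
- by rewrite gtr0_sg //; apply: pos; rewrite x0.
- rewrite ltr0_sg // (_ : (fun n => _) = (fun n => - iter n sgstep (- x))).
    by apply: cvgN; apply: pos; apply/andP; split; lra.
  by apply/funext => n; rewrite iter_sgstepN opprK.
- rewrite sgr0 (_ : (fun n => _) = (fun=> 0)); first exact: cvg_cst.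
  by apply/funext; elim=> //= n ->; rewrite /sgstep mul0r mul0r.
Qed.

End SignIteration.

(** * Integer powers of the coordinate *)

Section CircleCoordinate.
Variable R : realType.
Local Notation C := R[i].
Implicit Types z : circle R.

Lemma normc_circle z : Normc.normc (val z) = 1.
Proof.
have := valP z; rewrite normc_def; case: (val z) => x y /= /eqP h.
by have [] := h.
Qed.

Lemma circle_neq0 z : val z != 0.
Proof.
apply/eqP => z0; have := normc_circle z; rewrite z0 Normc.normc0 => /eqP.
by rewrite eq_sym oner_eq0.
Qed.

Lemma circle_conj z : (val z)^* = (val z)^-1.
Proof.
apply: (mulfI (circle_neq0 z)); rewrite divff ?circle_neq0 //.
have := normc_sqr (val z); rewrite normc_circle expr1n => h.
by apply: complex_eqP; rewrite !ReImE /=; [rewrite {1}h|]; ring.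
Qed.

Lemma normc_circleX z (n : int) : Normc.normc (val z ^ n) = 1.
Proof.
have X k : Normc.normc (val z ^+ k) = 1.
  elim: k => [|k IH]; first by rewrite expr0 Normc.normc1.
  by rewrite exprS Normc.normcM IH normc_circle mulr1.
by case: n => k; rewrite ?NegzE ?exprnN ?Normc.normcV X ?invr1.
Qed.

Lemma circle_conjX z (n : int) : (val z ^ n)^* = val z ^ (- n).
Proof. by rewrite -exprz_inv -circle_conj rmorphXz // unitfE circle_neq0. Qed.

Lemma measurable_circle_coord : measurable_fun setT (@circle_coord R).
Proof. by move=> _ B mB; exists B. Qed.

Lemma cmeasurable_circle : cmeasurable (fun z => val z).
Proof.
split.
  exact: (measurableT_comp measurable_fst measurable_circle_coord).
exact: (measurableT_comp measurable_snd measurable_circle_coord).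
Qed.

Lemma cmeasurable_circleX (n : int) : cmeasurable (fun z => val z ^ n).
Proof.
have X k : cmeasurable (fun z => val z ^+ k).
  elim: k => [|k IH]; first exact: cmeasurable_cst.
  under eq_fun do rewrite exprS.
  by apply: cmeasurableM => //; exact: cmeasurable_circle.
case: n => k; first exact: X.
rewrite (_ : (fun z => _) = (fun z => (val z ^+ k.+1)^*)).
  exact: cmeasurableJ.
by apply/funext => z; rewrite (circle_conjX z k.+1) NegzE.
Qed.

End CircleCoordinate.

(** * Multipliers that preserve the vanishing of all Fourier coefficients *)

Section FourierUniqueness.
Variable R : realType.
Local Notation C := R[i].
Local Notation mu := (circle_measure R).
Implicit Types (h : circle R -> C) (f g : circle R -> R).

Definition null_fourier h := cintegrable h /\
  forall n : int, cintegral (fun z => h z * val z ^ n) = 0.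

(* These multipliers form an algebra that is stable under bounded pointwise
   limits and contains [Re z] and [Im z], hence all Borel indicator functions. *)
Definition null_multiplier f := [/\ measurable_fun setT f,
  (exists B, forall z, `|f z| <= B) &
  forall h, null_fourier h -> null_fourier (fun z => h z * (f z)%:C)].

Lemma normc_real (x : R) : Normc.normc x%:C = `|x|.
Proof. by rewrite /= expr0n addr0 sqrtr_sqr. Qed.

Lemma cintegrable_circleX h (n : int) : cintegrable h ->
  cintegrable (fun z => h z * val z ^ n).
Proof.
move=> ih; apply: (@cintegrableMbd _ _ _ 1) => //.
  exact: cmeasurable_circleX.
by move=> z; rewrite normc_circleX.
Qed.

Lemma null_fourier_lin (a b : C) h1 h2 : null_fourier h1 -> null_fourier h2 ->
  null_fourier (fun z => a * h1 z + b * h2 z).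
Proof.
move=> [i1 n1] [i2 n2]; split; first by apply: cintegrableD; exact: cintegrableZ.
move=> n; under [X in cintegral X]eq_fun do rewrite mulrDl -!mulrA.
rewrite cintegralD; last 2 first.
- by apply: cintegrableZ; exact: cintegrable_circleX.
- by apply: cintegrableZ; exact: cintegrable_circleX.
by rewrite !cintegralZ ?n1 ?n2 ?mulr0 ?addr0 //; exact: cintegrable_circleX.
Qed.

Lemma null_fourier_circleX h (k : int) : null_fourier h ->
  null_fourier (fun z => h z * val z ^ k).
Proof.
move=> [ih nh]; split; first exact: cintegrable_circleX.
move=> n; rewrite -[RHS](nh (k + n)); congr cintegral; apply/funext => z.
by rewrite -mulrA -expfzDr // circle_neq0.
Qed.

Lemma null_multiplier_cst (c : R) : null_multiplier (fun=> c).
Proof.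
split; [exact: measurable_cst|by exists (`|c|)|move=> h nh].
have := null_fourier_lin c%:C 0 nh nh; congr null_fourier.
by apply/funext => z; rewrite mul0r addr0 mulrC.
Qed.

Lemma null_multiplierD f g : null_multiplier f -> null_multiplier g ->
  null_multiplier (fun z => f z + g z).
Proof.
move=> [mf [B fB] nf] [mg [B' gB] ng]; split; first exact: measurable_funD.
  by exists (B + B') => z; apply: le_trans (ler_normD _ _) _; exact: lerD.
move=> h nh; have := null_fourier_lin 1 1 (nf _ nh) (ng _ nh).
congr null_fourier; apply/funext => z; rewrite !mul1r -mulrDr.
by rewrite rmorphD.
Qed.

Lemma null_multiplierM f g : null_multiplier f -> null_multiplier g ->
  null_multiplier (fun z => f z * g z).
Proof.
move=> [mf [B fB] nf] [mg [B' gB] ng]; split; first exact: measurable_funM.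
  by exists (B * B') => z; rewrite normrM; exact: ler_pM.
move=> h nh; have := ng _ (nf _ nh).
by congr null_fourier; apply/funext => z; rewrite -mulrA rmorphM.
Qed.

Lemma null_multiplierZ (c : R) f : null_multiplier f ->
  null_multiplier (fun z => c * f z).
Proof. by move=> nf; apply: null_multiplierM => //; exact: null_multiplier_cst. Qed.

(** On the circle $\mathrm{Re}\,z=(z+z^{-1})/2$, and multiplying by a power of $z$ only shifts the
    Fourier coefficients. The imaginary part is treated likewise. *)
Lemma null_multiplier_Re : null_multiplier (fun z => complex.Re (val z)).
Proof.
split; first exact: (cmeasurable_circle R).1.
  by exists 1 => z; apply: le_trans (ler_Re_normc _) _; rewrite normc_circle.
move=> h nh; have := null_fourier_lin 2^-1 2^-1
  (null_fourier_circleX 1 nh) (null_fourier_circleX (-1) nh).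
congr null_fourier; apply/funext => z; rewrite -!mulrDr mulrCA.
congr (_ * _); rewrite -circle_conjX expr1z addcJ mulrA mulVf ?mul1r //.
Qed.

Lemma null_multiplier_Im : null_multiplier (fun z => complex.Im (val z)).
Proof.
split; first exact: (cmeasurable_circle R).2.
  by exists 1 => z; apply: le_trans (ler_Im_normc _) _; rewrite normc_circle.
move=> h nh; have := null_fourier_lin (- 'i / 2) ('i / 2)
  (null_fourier_circleX 1 nh) (null_fourier_circleX (-1) nh).
congr null_fourier; apply/funext => z; rewrite mulrCA [X in _ + X]mulrCA -mulrDr.
congr (_ * _); rewrite -circle_conjX expr1z.
have -> : (2^-1 : C) = (2^-1)%:C by rewrite -[X in X^-1](rmorph_nat (real_complex R)) fmorphV.
by apply: complex_eqP; rewrite !ReImE /=; field.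
Qed.

(** Dominated convergence in each Fourier coefficient. It is applied to real integrands: the real
    and imaginary parts [r] of $h z^k$, with majorant $B|r|$. *)
Lemma null_multiplier_lim (F : nat -> circle R -> R) f (B : R) :
  (forall n, null_multiplier (F n)) -> (forall n z, `|F n z| <= B) ->
  (forall z, F ^~ z @ \oo --> f z) -> null_multiplier f.
Proof.
move=> nF FB Ff.
have mF n : measurable_fun setT (F n) by case: (nF n).
have mf : measurable_fun setT f by apply: (measurable_fun_cvg mF) => z _; exact: Ff.
have fB z : `|f z| <= B.
  have : (fun n => `|F n z|) @ \oo --> `|f z| by apply: cvg_norm; exact: Ff.
  move=> cv; rewrite -(cvg_lim _ cv) //; apply: limr_le.
    by apply/cvg_ex; exists `|f z|.
  by near=> n; exact: FB.
split => //; first by exists B.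
move=> h nh; have [ih _] := nh.
have bd (g : circle R -> R) : measurable_fun setT g -> (forall z, `|g z| <= B) ->
    cintegrable (fun z => h z * (g z)%:C).
  move=> mg gB; apply: (@cintegrableMbd _ h (fun z => (g z)%:C) B) => //.
  by move=> z; rewrite normc_real.
split; first exact: bd.
move=> k.
have real_lim (r : circle R -> R) : mu.-integrable setT (EFin \o r) ->
    (forall n, Rintegral mu setT (fun z => r z * F n z) = 0) ->
    Rintegral mu setT (fun z => r z * f z) = 0.
  move=> ir r0.
  have mr := integrable_measurable_real ir.
  have irF n : mu.-integrable setT (EFin \o (fun z => r z * F n z)).
    apply: (@integrable_dom _ _ (fun z => B * `|r z|)).
    + exact: measurable_funM.
    + by apply: integrable_realZ; exact: integrable_norm.
    + by move=> z; rewrite normrM mulrC; apply: ler_wpM2r.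
  have [|||||_ _] := @dominated_convergence _ _ _ mu setT measurableT
     (fun n z => (r z * F n z)%:E) (fun z => (r z * f z)%:E)
     (fun z => (B * `|r z|)%:E).
  - by move=> n; apply/measurable_EFinP; exact: measurable_funM.
  - by apply/measurable_EFinP; exact: measurable_funM.
  - apply: aeW => z _; apply: cvg_EFin; first by near=> n.
    by apply: cvgM; [exact: cvg_cst|exact: Ff].
  - by apply: integrable_realZ; exact: integrable_norm.
  - apply: aeW => z n _ /=; rewrite lee_fin normrM mulrC; apply: ler_wpM2r => //.
  rewrite (_ : [sequence _]_n = cst 0%E); last first.
    apply/funext => n /=.
    rewrite -[LHS]fineK; last exact: (integrable_fin_num measurableT (irF n)).
    by rewrite -[X in X%:E]/(Rintegral mu setT (fun z => r z * F n z)) r0.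
  by move=> /cvg_lim h0; rewrite /Rintegral -h0 // lim_cst.
have split_k (g : circle R -> R) : cintegral (fun z => h z * (g z)%:C * val z ^ k) =
    Rintegral mu setT (fun z => complex.Re (h z * val z ^ k) * g z) +i*
    Rintegral mu setT (fun z => complex.Im (h z * val z ^ k) * g z).
  rewrite /cintegral; congr (_ +i* _); apply: eq_Rintegral => z _;
    by rewrite !ReImE /=; ring.
have [i1 i2] := cintegrable_circleX k ih.
rewrite split_k !real_lim // => n.
- have [_ _ /(_ _ nh)[_ /(_ k)]] := nF n.
  by rewrite split_k => /(congr1 (@complex.Im R)).
- have [_ _ /(_ _ nh)[_ /(_ k)]] := nF n.
  by rewrite split_k => /(congr1 (@complex.Re R)).
Unshelve. all: by end_near.
Qed.

End FourierUniqueness.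

(** * From multipliers to Borel sets: uniqueness of Fourier coefficients *)

Section NullMultiplierSets.
Variable R : realType.
Local Notation C := R[i].
Local Notation mu := (circle_measure R).
Implicit Types (h : circle R -> C) (f g : circle R -> R) (A B : set (circle R)).

(** The iterates of [sgstep] at [f] are polynomials in [f], hence multipliers, and they remain in
    $[-1,1]$ while converging to the sign. *)
Lemma null_multiplier_sg f : null_multiplier f -> (forall z, `|f z| <= 1) ->
  null_multiplier (fun z => Num.sg (f z)).
Proof.
move=> nf f1.
have bd n z : `|iter n (@sgstep R) (f z)| <= 1.
  by elim: n => //= n IH; exact: sgstep_bound.
apply: (@null_multiplier_lim _ (fun n z => iter n (@sgstep R) (f z)) _ 1).
- elim=> //= n IH.
  have -> : (fun z => sgstep (iter n (@sgstep R) (f z))) =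
      (fun z => iter n (@sgstep R) (f z) * (2^-1 * (3 + (-1) *
        (iter n (@sgstep R) (f z) * iter n (@sgstep R) (f z))))).
    by apply/funext => z; rewrite /sgstep; field.
  apply: null_multiplierM => //; apply: null_multiplierZ.
  apply: null_multiplierD; first exact: null_multiplier_cst.
  by apply: null_multiplierZ; exact: null_multiplierM.
- exact: bd.
- by move=> z; exact: iter_sgstep_cvg.
Qed.

Definition null_set A := null_multiplier (\1_A : circle R -> R).

Lemma null_set_pos f : null_multiplier f -> null_set [set z | 0 < f z].
Proof.
move=> nf; have [_ [b' fb'] _] := nf.
pose b : R := b'; have fb z : `|f z| <= b by exact: fb'.
(* Dividing by [c] brings [f] into $[-1,1]$ without changing its sign. *)
pose c : R := 1 + `|b|.
have c0 : 0 < c by rewrite /c ltr_pwDl.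
have nsg : null_multiplier (fun z => Num.sg (c^-1 * f z)).
  apply: null_multiplier_sg; first exact: null_multiplierZ.
  move=> z; rewrite normrM ger0_norm ?invr_ge0 ?(ltW c0) // ler_pdivrMl // mulr1.
  by apply: le_trans (fb z) _; rewrite /c; have := ler_norm b; lra.
(* For a sign $s$, $(s+s^2)/2$ is 1 if $s=1$ and 0 if $s$ is 0 or -1. *)
have := null_multiplierZ 2^-1 (null_multiplierD nsg (null_multiplierM nsg nsg)).
congr null_multiplier; apply/funext => z; rewrite indicE.
rewrite sgrM gtr0_sg ?invr_gt0 // mul1r.
case: (ltrgt0P (f z)) => fz.
- by rewrite gtr0_sg // mem_set //=; field.
- rewrite ltr0_sg // memNset /=; first by field.
  by rewrite ltNge ltW.
- rewrite fz sgr0 memNset /=; first by field.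
  by rewrite fz ltxx.
Qed.

Lemma null_set_setC A : null_set A -> null_set (~` A).
Proof.
move=> nA; have := null_multiplierD (@null_multiplier_cst R 1) (null_multiplierZ (-1) nA).
congr null_multiplier; apply/funext => z; rewrite indicC indicE.
by case: (z \in A) => /=; ring.
Qed.

Lemma null_set_setI A B : null_set A -> null_set B -> null_set (A `&` B).
Proof. by move=> nA nB; rewrite /null_set indicI; exact: null_multiplierM. Qed.

Lemma null_set_setU A B : null_set A -> null_set B -> null_set (A `|` B).
Proof.
by move=> /null_set_setC nA /null_set_setC nB; rewrite -[_ `|` _]setCK setCU;
  apply: null_set_setC; exact: null_set_setI.
Qed.

Lemma null_set_set0 : null_set set0.
Proof.
have := @null_multiplier_cst R 0; congr null_multiplier; apply/funext => z.
by rewrite indic0.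
Qed.

Lemma null_set_bigcup (A : nat -> set (circle R)) :
  (forall n, null_set (A n)) -> null_set (\bigcup_n A n).
Proof.
move=> nA; pose B n := \bigcup_(i < n) A i.
apply: (@null_multiplier_lim _ (fun n => \1_(B n)) _ 1).
- move=> n; rewrite /B bigcup_mkord; apply: (@big_ind _ null_set) => //.
  + exact: null_set_set0.
  + exact: null_set_setU.
- by move=> n z; rewrite indicE; case: (_ \in _); rewrite ?normr1 ?normr0 ?lexx ?ler01.
- move=> z; apply: cvg_near_cst; case: (pselect ((\bigcup_n A n) z)) => [[k _ Ak]|nAz].
    exists k.+1 => // n /= kn; rewrite !indicE !mem_set //; first by exists k.
    by exists k.
  apply: nearW => n; rewrite !indicE !memNset // => -[k _ Ak].
  by apply: nAz; exists k.
Qed.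

Lemma null_set_preimage_sigma (T : Type) (p : circle R -> T) :
  sigma_algebra setT [set B | null_set (p @^-1` B)].
Proof.
split => /=.
- by rewrite preimage_set0; exact: null_set_set0.
- by move=> B nB; rewrite setTD preimage_setC; exact: null_set_setC.
- by move=> B nB; rewrite preimage_bigcup; exact: null_set_bigcup.
Qed.

Lemma null_set_preimage_real f : null_multiplier f ->
  forall B : set (measurableTypeR R), measurable B -> null_set (f @^-1` B).
Proof.
move=> nf B; rewrite [measurable B](_ : _ = (RGenOInfty.G (R:=R)).-sigma.-measurable B);
  last by rewrite -RGenOInfty.measurableE.
apply: (smallest_sub (null_set_preimage_sigma f)) => _ [x ->] /=.
rewrite (_ : _ @^-1` _ = [set z | 0 < f z + - x]).
  apply: null_set_pos; apply: null_multiplierD => //; exact: null_multiplier_cst.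
by apply/seteqP; split => z /=; rewrite in_itv /= andbT subr_gt0.
Qed.

(** A Borel set of the circle is the trace of one of the plane, and the latter are generated by
    rectangles, whose traces are intersections of preimages under the real and imaginary parts. *)
Lemma measurable_null_set A : measurable A -> null_set A.
Proof.
move=> [B mB <-]; rewrite setTI; move: B mB.
rewrite measurable_prod_measurableType.
apply: (smallest_sub (null_set_preimage_sigma _)) => _ [X mX [Y mY <-]] /=.
rewrite (_ : _ @^-1` _ = ((fun z => complex.Re (val z)) @^-1` X) `&`
   ((fun z => complex.Im (val z)) @^-1` Y)) //.
by apply: null_set_setI; apply: null_set_preimage_real => //;
  [exact: null_multiplier_Re|exact: null_multiplier_Im].
Qed.

(** With the indicator of [A] as multiplier, the coefficient of index 0 is the integral of [h] over
    [A]. All these integrals vanish, so [h] does a.e. *)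
Lemma null_fourier_ae0 h : null_fourier h -> {ae mu, forall z, h z = 0}.
Proof.
move=> nh; have [[i1 i2] _] := nh.
have I0 A : measurable A ->
    (\int[mu]_(z in A) (complex.Re (h z))%:E = 0 /\
     \int[mu]_(z in A) (complex.Im (h z))%:E = 0)%E.
  move=> mA; have [_ _ /(_ _ nh)[[j1 j2] /(_ 0)]] := measurable_null_set mA.
  under [X in cintegral X]eq_fun do rewrite expr0z mulr1.
  have E (r : circle R -> R) : (\int[mu]_(z in A) (r z)%:E =
      \int[mu]_z (r z * \1_A z)%:E)%E.
    rewrite -[A in LHS]setTI integral_mkcondr; apply: eq_integral => z _.
    by rewrite patchE indicE; case: (_ \in _); rewrite ?mulr1 ?mulr0.
  rewrite /cintegral /Rintegral => -[].
  under eq_integral do rewrite cReM /= mulr0 subr0.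
  under [X in _ -> fine X = _ -> _]eq_integral do rewrite cImM /= mulr0 add0r.
  rewrite !E => k1 k2; split; rewrite -[LHS]fineK ?k1 ?k2 //.
    move: j1; rewrite (_ : _ \o _ = fun z => (complex.Re (h z) * \1_A z)%:E).
      exact: integrable_fin_num.
    by apply/funext => z /=; rewrite cReM /= mulr0 subr0.
  move: j2; rewrite (_ : _ \o _ = fun z => (complex.Im (h z) * \1_A z)%:E).
    exact: integrable_fin_num.
  by apply/funext => z /=; rewrite cImM /= mulr0 add0r.
have a1 : ae_eq mu setT (EFin \o (fun z => complex.Re (h z))) (cst 0%E).
  apply: integral_ae_eq => // E _ mE.
  by rewrite integral0; exact: (I0 E mE).1.
have a2 : ae_eq mu setT (EFin \o (fun z => complex.Im (h z))) (cst 0%E).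
  apply: integral_ae_eq => // E _ mE.
  by rewrite integral0; exact: (I0 E mE).2.
apply: filterS2 a1 a2 => z /(_ I)[r0] /(_ I)[s0].
exact: complex_eqP.
Qed.

End NullMultiplierSets.

(** * Orthonormality of the exponentials and Parseval on the circle *)

Section Orthonormality.
Variable R : realType.
Local Notation C := R[i].
Local Notation mu := (circle_measure R).

Lemma expiX (t : R) n : val (expi t) ^+ n =
  cos (n%:R * (2 * pi) * t) +i* sin (n%:R * (2 * pi) * t).
Proof.
elim: n => [|n IH]; first by rewrite expr0 !mul0r cos0 sin0.
rewrite exprS IH; have -> : n.+1%:R * (2 * pi) * t =
  2 * pi * t + n%:R * (2 * pi) * t by rewrite -[n.+1]add1n natrD; ring.
by apply: complex_eqP; rewrite !ReImE /= ?cosD ?sinD; ring.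
Qed.

Lemma integral_circle (f : circle R -> R) : mu.-integrable setT (EFin \o f) ->
  (\int[mu]_z (f z)%:E = \int[lebesgue_measure]_(t in `[0%R, 1%R]) (f (expi t))%:E)%E.
Proof.
move=> fi; have mf := integrable_measurable_real fi.
pose nu := mrestr (@lebesgue_measure R) (measurable_itv `[0%R, 1%R]).
have mfe : measurable_fun [set: measurableTypeR R] (f \o @expi R).
  by apply: measurableT_comp => //; exact: measurable_expi.
have ni : nu.-integrable (@expi R @^-1` setT) ((EFin \o f) \o @expi R).
  rewrite preimage_setT; apply/integrableP; split; first exact/measurable_EFinP.
  have mabs : measurable_fun setT (fun y => `|(EFin \o f) y|%E).
    by apply: measurableT_comp => //; exact/measurable_EFinP.
  have /integrableP[_] := fi.
  by rewrite (ge0_integral_pushforward (@measurable_expi R)).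
rewrite [LHS](@integral_pushforward _ _ _ _ _ _ (@measurable_expi R) nu setT (EFin \o f)) //;
  last exact/measurable_EFinP.
rewrite preimage_setT in ni *.
(* The restricted measure still lives on the whole line; the complement of $[0,1]$ is null for
   it. *)
rewrite (@negligible_integral _ _ _ nu setT (~` `[0%R, 1%R])) //; last 2 first.
- exact: measurableC.
- rewrite -[LHS]/(lebesgue_measure (~` `[0%R, 1%R] `&` `[0%R, 1%R])).
  by rewrite setICl measure0.
rewrite setTD setCK; apply: eq_measure_integral => A mA A01.
rewrite -[LHS]/(lebesgue_measure (A `&` `[0%R, 1%R])).
by rewrite setIidl.
Qed.

Lemma integral_trig n : (0 < n)%N ->
  (\int[lebesgue_measure]_(t in `[0%R, 1%R]) (cos (n%:R * (2 * pi) * t) : R)%:E = 0)%E /\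
  (\int[lebesgue_measure]_(t in `[0%R, 1%R]) (sin (n%:R * (2 * pi) * t) : R)%:E = 0)%E.
Proof.
move=> n0; set c : R := n%:R * (2 * pi).
have c0 : c != 0 by rewrite mulf_neq0 ?pnatr_eq0 -?lt0n // mulf_neq0 // gt_eqF ?pi_gt0.
(* Both values are read off from [expi 1 = 1] raised to the power [n]. *)
have [cos1 sin1] : cos c = 1 /\ sin c = 0.
  have e1 : val (expi (1 : R)) = 1.
    by rewrite /= mulr1 mulr_natl cos2pi sin2pi.
  have := expiX (1 : R) n; rewrite e1 expr1n -/c mulr1 => -[-> ->] //.
have dlin (t : R) : is_derive t 1 (fun t => c * t) c.
  by apply: is_derive_eq; rewrite /GRing.scale /= mulr1.
have clin : continuous (fun t : R => c * t) by exact: mulrl_continuous.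
have ds (t : R) : is_derive t 1 (fun t => c^-1 * sin (c * t)) (cos (c * t)).
  have h : is_derive t 1 (sin \o (fun t => c * t)) (cos (c * t) * c).
    exact: is_derive1_comp.
  have := is_deriveZ c^-1 h; rewrite [_ *: _](_ : _ = cos (c * t)) //.
  by rewrite /GRing.scale /= mulrCA mulVf // mulr1.
have dc (t : R) : is_derive t 1 (fun t => - c^-1 * cos (c * t)) (sin (c * t)).
  have h : is_derive t 1 (cos \o (fun t => c * t)) (- sin (c * t) * c).
    exact: is_derive1_comp.
  have := is_deriveZ (- c^-1) h; rewrite [_ *: _](_ : _ = sin (c * t)) //.
  by rewrite /GRing.scale /= [LHS]mulrCA [- c^-1 * c]mulNr mulVf // mulrN1 opprK.
have ftc (F f : R -> R) : continuous f -> (forall t : R, is_derive t 1 F (f t)) ->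
    F 1 = F 0 -> (\int[lebesgue_measure]_(t in `[0%R, 1%R]) (f t)%:E = 0)%E.
  move=> cf dF F10.
  have cF : continuous F.
    by move=> t; apply: differentiable_continuous; apply/derivable1_diffP; exact: ex_derive.
  rewrite (@continuous_FTC2 _ _ F) //.
  - by rewrite F10 subee.
  - exact: continuous_subspaceT.
  - by split => [t _| |]; [exact: (@ex_derive _ _ _ _ _ _ _ (dF t))|
      apply: cvg_at_right_filter; exact: cF|apply: cvg_at_left_filter; exact: cF].
  - by move=> t _; rewrite derive1E; exact: derive_val.
split.
- apply: (ftc (fun t => c^-1 * sin (c * t))) => //.
    by move=> t; apply: continuous_comp; [exact: clin|exact: continuous_cos].
  by rewrite mulr1 mulr0 sin1 sin0.
- apply: (ftc (fun t => - c^-1 * cos (c * t))) => //.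
    by move=> t; apply: continuous_comp; [exact: clin|exact: continuous_sin].
  by rewrite mulr1 mulr0 cos1 cos0.
Qed.

Lemma cintegral_circleX (n : int) :
  cintegral (fun z : circle R => val z ^ n) = (n == 0)%:R.
Proof.
have icX k : cintegrable (fun z : circle R => val z ^ k).
  apply: (@cintegrable_bd _ _ 1); first exact: cmeasurable_circleX.
  by move=> z; rewrite normc_circleX.
have pos k : (0 < k)%N -> cintegral (fun z : circle R => val z ^ (Posz k)) = 0.
  move=> k0; have [i1 i2] := icX k; have [h1 h2] := integral_trig k0.
  rewrite /cintegral /Rintegral !integral_circle //.
  under eq_integral do rewrite -exprnP expiX /=.
  rewrite h1; under eq_integral do rewrite -exprnP expiX /=.
  by rewrite h2.
case: n => [[|k]|k]; last 2 first.
- by rewrite pos.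
- rewrite (_ : (fun z => _) = (fun z => (val z ^ (Posz k.+1))^*)).
    by rewrite cintegralJ // pos // rmorph0.
  by apply/funext => z; rewrite circle_conjX NegzE.
rewrite /cintegral /=.
by rewrite !Rintegral_cst // mul0r mul1r [X in fine X]circle_measureT.
Qed.

Variable m : nat.

Definition fourier_basis (p : int * 'I_m) : circle R -> 'cV[C]_m :=
  fun z => val z ^ p.1 *: delta_mx p.2 ord0.

Lemma fourier_basisE p z i : fourier_basis p z i ord0 = (i == p.2)%:R * val z ^ p.1.
Proof. by rewrite !mxE eqxx andbT mulrC. Qed.

Lemma L2_fourier_basis p : L2 (fourier_basis p).
Proof.
apply: (@L2_bd _ _ _ m%:R).
- move=> i; under eq_fun do rewrite fourier_basisE; apply: cmeasurableM.
    exact: cmeasurable_cst.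
  exact: cmeasurable_circleX.
- move=> z; rewrite /cvnorm2.
  have -> : m%:R = \sum_(i < m) 1 :> R by rewrite sumr_const card_ord.
  apply: ler_sum => i _; rewrite fourier_basisE Normc.normcM normc_circleX mulr1.
  by case: (_ == _); rewrite ?Normc.normc1 ?Normc.normc0 ?expr1n // expr0n.
Qed.

Lemma cvdot_fourier_basis (v : 'cV[C]_m) n i z :
  cvdot v (fourier_basis (n, i) z) = v i ord0 * val z ^ (- n).
Proof.
have conjX : ((val z ^ n)^*)%R = val z ^ (- n) :> C := circle_conjX z n.
rewrite /cvdot (bigD1 i) // big1 => [|j /= ji].
  by rewrite fourier_basisE eqxx mul1r conjX; exact: addr0.
by rewrite fourier_basisE (negbTE ji) mul0r rmorph0 mulr0.
Qed.

Lemma L2ip_fourier_basis f n i :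
  L2ip f (fourier_basis (n, i)) = cintegral (fun z => f z i ord0 * val z ^ (- n)).
Proof. by congr cintegral; apply/funext => z; exact: cvdot_fourier_basis. Qed.

Lemma fourier_basis_orthonormal p q :
  L2ip (fourier_basis p) (fourier_basis q) = (p == q)%:R.
Proof.
case: p q => [n i] [k j]; rewrite L2ip_fourier_basis xpair_eqE.
rewrite [i == j]eq_sym; case: (eqVneq j i) => [->|ji]; rewrite ?andbT ?andbF.
  by rewrite -subr_eq0 -cintegral_circleX; congr cintegral; apply/funext => z;
    rewrite fourier_basisE eqxx mul1r -expfzDr // circle_neq0.
rewrite -[RHS]cintegral0; congr cintegral; apply/funext => z.
by rewrite fourier_basisE (negbTE ji) !mul0r.
Qed.

Lemma L2_coord_cintegrable (f : circle R -> 'cV[C]_m) i :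
  L2 f -> cintegrable (fun z => f z i ord0).
Proof.
move=> Lf; have := cintegrable_cvdot Lf (L2_fourier_basis (0, i)).
congr cintegrable; apply/funext => z.
by rewrite cvdot_fourier_basis oppr0 expr0z mulr1.
Qed.

(** Totality of the basis is the uniqueness of Fourier coefficients, used in each coordinate. *)
Lemma fourier_parseval (f : circle R -> 'cV[C]_m) : L2 f ->
  (\esum_(p in [set: int * 'I_m]) (Normc.normc (L2ip f (fourier_basis p)) ^+ 2)%:E
    = (hnorm L2ip f ^+ 2)%:E)%E.
Proof.
move=> Lf; apply: (parseval (L2_sip R m)) => //.
- exact: L2_fourier_basis.
- exact: fourier_basis_orthonormal.
- exact: L2_rapidly_complete.
move=> g Lg g0; apply/hnorm_eq0 => //.
have ae_coord i : {ae mu, forall z, g z i ord0 = 0}.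
  apply: null_fourier_ae0; split; first exact: L2_coord_cintegrable.
  by move=> n; rewrite -(g0 (- n, i)) L2ip_fourier_basis opprK.
have : {ae mu, forall z i, g z i ord0 = 0}.
  by apply: filter_forall => i; exact: ae_coord.
by apply: filterS => z gz; apply/colP => i; rewrite gz mxE.
Qed.

End Orthonormality.

(** * Orthogonal projection matrices and the splitting off of lines *)

Section OrthogonalProjections.
Variables (R : realType) (m : nat).
Local Notation C := R[i].
Implicit Types (v w : 'cV[C]_m) (P Q : 'M[C]_m).

Lemma conj_realc (x : R) : ((x%:C)^*)%R = x%:C.
Proof. by rewrite -[LHS]/(conjc x%:C); apply: complex_eqP; rewrite /= ?oppr0. Qed.

Lemma cvdot_linl a v1 v2 w : cvdot (a *: v1 + v2) w = a * cvdot v1 w + cvdot v2 w.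
Proof.
rewrite /cvdot mulr_sumr -big_split /=; apply: eq_bigr => i _.
by rewrite !mxE mulrDl mulrA.
Qed.

(** Makes the general lemmas on semi-inner products available at each point of the circle. *)
Lemma cvdot_sip : @semi_inner_product R 'cV[C]_m setT (@cvdot R m).
Proof.
split => //.
- by move=> a x y z _ _ _; exact: cvdot_linl.
- by move=> x y _ _; exact: cvdotJ.
- by move=> x _; rewrite -cvnorm2E; exact: cvnorm2_ge0.
Qed.

Lemma cvdotBl v1 v2 w : cvdot (v1 - v2) w = cvdot v1 w - cvdot v2 w.
Proof. exact: (ipBl cvdot_sip). Qed.

Lemma cvdotBr v1 v2 w : cvdot w (v1 - v2) = cvdot w v1 - cvdot w v2.
Proof. exact: (ipBr cvdot_sip). Qed.

Lemma cvdotZl a v w : cvdot (a *: v) w = a * cvdot v w.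
Proof. exact: (ipZl cvdot_sip). Qed.

Lemma cvdotZr a v w : cvdot v (a *: w) = a^* * cvdot v w.
Proof. exact: (ipZr cvdot_sip). Qed.

Lemma cvdot0l w : cvdot 0 w = 0.
Proof. exact: (ip0l cvdot_sip). Qed.

Lemma cvdot0r w : cvdot w 0 = 0.
Proof. exact: (ip0r cvdot_sip). Qed.

Lemma cvdotvv v : cvdot v v = (cvnorm2 v)%:C.
Proof.
apply: complex_eqP; first by rewrite -cvnorm2E.
have := congr1 (@complex.Im R) (cvdotJ v v); rewrite cImJ /= => h.
by apply/eqP; rewrite -[_ == _](@mulrn_eq0 _ _ 2) mulr2n {1}h addNr.
Qed.

Lemma cvdot_cs v w : Normc.normc (cvdot v w) ^+ 2 <= cvnorm2 v * cvnorm2 w.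
Proof.
have := cauchy_schwarz cvdot_sip (x := v) (y := w) I I.
by rewrite !(hnormE cvdot_sip) // -!cvnorm2E.
Qed.

Lemma cvnorm2Z a v : cvnorm2 (a *: v) = Normc.normc a ^+ 2 * cvnorm2 v.
Proof. by have := hnormZ cvdot_sip a (x := v) I; rewrite !(hnormE cvdot_sip) // -!cvnorm2E. Qed.

Lemma cvdot_delta v i : cvdot v (delta_mx i ord0) = v i ord0.
Proof.
rewrite /cvdot (bigD1 i) // big1 => [|j /= ji].
  by rewrite mxE !eqxx rmorph1 mulr1; exact: addr0.
by rewrite mxE (negbTE ji) rmorph0 mulr0.
Qed.

Definition rank1 v : 'M[C]_m := \matrix_(i, j) (v i ord0 * (v j ord0)^*).

Lemma rank1E v w : rank1 v *m w = cvdot w v *: v.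
Proof.
apply/colP => i; rewrite !mxE /cvdot mulr_suml; apply: eq_bigr => j _.
by rewrite !mxE mulrC [X in _ * X]mulrC mulrA.
Qed.

Lemma mxtrace_rank1 v : \tr (rank1 v) = (cvnorm2 v)%:C.
Proof. by rewrite -cvdotvv; apply: eq_bigr => i _; rewrite mxE. Qed.

Lemma eq_mulmx_cV P Q : (forall v, P *m v = Q *m v) -> P = Q.
Proof. by move=> PQ; apply/row_matrixP => i; apply/matrixP => a j; move: (PQ (delta_mx j ord0));
  rewrite -!colE => /colP/(_ i); rewrite !mxE. Qed.

Definition orthoprojmx P := P *m P = P /\
  forall v w, cvdot (P *m v) w = cvdot v (P *m w).

Lemma orthoprojmx_compl P : orthoprojmx P -> orthoprojmx (1%:M - P).
Proof.
move=> [PP Psa]; split.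
  by rewrite mulmxBl mul1mx mulmxBr mulmx1 PP subrr subr0.
by move=> v w; rewrite !mulmxBl !mul1mx cvdotBl cvdotBr Psa.
Qed.

Lemma orthoprojmx_norm P v : orthoprojmx P -> (cvnorm2 (P *m v))%:C = cvdot (P *m v) v.
Proof. by move=> [PP Psa]; rewrite -cvdotvv Psa mulmxA PP -Psa. Qed.

(** A diagonal entry is $\langle Pe_i,e_i\rangle=\|Pe_i\|^2$. In particular only the zero projection
    has trace at most 0. *)
Lemma mxtrace_orthoprojmx P : orthoprojmx P ->
  \tr P = (\sum_i cvnorm2 (col i P))%:C.
Proof.
move=> oP; rewrite rmorph_sum; apply: eq_bigr => i _.
by rewrite /= colE orthoprojmx_norm // cvdot_delta -colE mxE.
Qed.

Lemma col_eq0 P : (forall i, col i P = 0) -> P = 0.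
Proof. by move=> P0; apply/matrixP => i j; have /colP/(_ i) := P0 j; rewrite !mxE. Qed.

Lemma mxtrace_orthoprojmx_eq0 P : orthoprojmx P -> complex.Re (\tr P) <= 0 -> P = 0.
Proof.
move=> oP; rewrite mxtrace_orthoprojmx //= => h; apply: col_eq0 => i.
apply: cvnorm2_eq0; apply/eqP; rewrite eq_le cvnorm2_ge0 andbT.
apply: le_trans h; rewrite (bigD1 i) //= lerDl.
by apply: sumr_ge0 => j _; exact: cvnorm2_ge0.
Qed.

(* Splits the line of [v] off the range of [P]; nothing changes when [v = 0],
   as then [(cvnorm2 v)^-1 = 0]. *)
Definition deflate P v := P - ((cvnorm2 v)^-1)%:C *: rank1 v.

Lemma deflateE P v w :
  deflate P v *m w = P *m w - (((cvnorm2 v)^-1)%:C * cvdot w v) *: v.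
Proof. by rewrite /deflate mulmxBl -scalemxAl rank1E scalerA. Qed.

(** Keeping the vector [v] as a factor makes the cancellation valid for [v = 0] too, so later
    computations need no case distinction. *)
Lemma cvnorm2VK v : (((cvnorm2 v)^-1)%:C * (cvnorm2 v)%:C) *: v = v.
Proof.
have [v0|v0] := eqVneq (cvnorm2 v) 0.
  by rewrite (cvnorm2_eq0 v0) scaler0.
by rewrite -rmorphM mulVf // scale1r.
Qed.

Lemma orthoprojmx_deflate P v : orthoprojmx P -> P *m v = v ->
  orthoprojmx (deflate P v).
Proof.
move=> [PP Psa] Pv; split; last first.
  move=> x y; rewrite !deflateE cvdotBl cvdotBr Psa cvdotZl cvdotZr.
  have -> : ((((cvnorm2 v)^-1)%:C * cvdot y v)^*)%R = ((cvnorm2 v)^-1)%:C * cvdot v y.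
    rewrite -[LHS]/(conjc (((cvnorm2 v)^-1)%:C * cvdot y v)) (cvdotJ v y).
    by apply: complex_eqP; rewrite !ReImE /=; ring.
  by rewrite mulrAC.
apply: eq_mulmx_cV => w; rewrite -mulmxA [in LHS]deflateE deflateE.
set c := ((cvnorm2 v)^-1)%:C.
rewrite mulmxBr mulmxA PP -scalemxAr Pv cvdotBl Psa Pv cvdotZl cvdotvv.
have -> : (c * (cvdot w v - c * cvdot w v * (cvnorm2 v)%:C)) *: v =
    (c * cvdot w v) *: (v - (c * (cvnorm2 v)%:C) *: v).
  by rewrite scalerBr scalerA -scalerBl; congr (_ *: _); ring.
by rewrite cvnorm2VK subrr scaler0 subr0.
Qed.

Lemma mulmx_deflate P v : orthoprojmx P -> deflate P (P *m v) *m v = 0.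
Proof.
move=> oP; have [PP Psa] := oP.
rewrite deflateE -Psa -(orthoprojmx_norm v oP) cvnorm2VK subrr //.
Qed.

Lemma mulmx_deflate0 P v w : orthoprojmx P -> P *m v = v -> P *m w = 0 ->
  deflate P v *m w = 0.
Proof.
move=> [_ Psa] Pv Pw; rewrite deflateE Pw -Pv -Psa Pw cvdot0l mulr0 scale0r subr0 //.
Qed.

Lemma mxtrace_deflate P v : v != 0 -> \tr (deflate P v) = \tr P - 1.
Proof.
move=> v0; have n0 : cvnorm2 v != 0 by apply: contra v0 => /eqP/cvnorm2_eq0 ->.
by rewrite /deflate raddfB /= mxtraceZ mxtrace_rank1 -rmorphM mulVf.
Qed.

Lemma deflate0 P : deflate P 0 = P.
Proof. by rewrite /deflate cvnorm20 invr0 scale0r subr0. Qed.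

Lemma mxtrace_deflate_ge P v :
  complex.Re (\tr P) - 1 <= complex.Re (\tr (deflate P v)).
Proof.
have [->|v0] := eqVneq v 0; first by rewrite deflate0; lra.
by rewrite mxtrace_deflate // cReD cReN.
Qed.

Lemma mulmx_deflatel P Q v : P *m Q = Q -> P *m v = v ->
  P *m deflate Q v = deflate Q v.
Proof.
move=> PQ Pv; apply: eq_mulmx_cV => w.
by rewrite -mulmxA deflateE mulmxBr mulmxA PQ -scalemxAr Pv.
Qed.

(** An explicit finite selection, so that it is measurable in the entries of [P]; the default 0 is
    reached only for [P = 0]. *)
Definition first_col P : 'cV[C]_m :=
  foldr (fun i v => if 0 < cvnorm2 (col i P) then col i P else v) 0 (enum 'I_m).

Lemma mulmx_first_col P : P *m P = P -> P *m first_col P = first_col P.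
Proof.
move=> PP; rewrite /first_col; elim: (enum _) => [|i s IH] /=; first by rewrite mulmx0.
by case: ifP => // _; rewrite colE mulmxA PP.
Qed.

Lemma first_col_eq0 P : first_col P = 0 -> P = 0.
Proof.
move=> P0; apply: col_eq0 => i.
have : i \in enum 'I_m by rewrite mem_enum.
move: P0; rewrite /first_col; elim: (enum _) => [|j s IH] //=.
case: ifPn => [jP P0|]; first by move: jP; rewrite P0 cvnorm20 ltxx.
rewrite -leNgt => jP P0; rewrite inE => /orP[/eqP ->|]; last exact: IH.
by apply: cvnorm2_eq0; apply/eqP; rewrite eq_le jP cvnorm2_ge0.
Qed.

Lemma first_col0 : first_col 0 = 0.
Proof.
rewrite /first_col; elim: (enum _) => [|j s IH] //=.
by rewrite (_ : col j 0 = 0) ?cvnorm20 ?ltxx //; apply/colP => i; rewrite !mxE.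
Qed.

Definition normalize v := ((Num.sqrt (cvnorm2 v))^-1)%:C *: v.

Lemma cvnorm2_normalize v : cvnorm2 (normalize v) <= 1.
Proof.
rewrite cvnorm2Z normc_real -normrX ger0_norm ?sqr_ge0 //.
rewrite exprVn sqr_sqrtr ?cvnorm2_ge0 //.
have [->|v0] := eqVneq (cvnorm2 v) 0; first by rewrite mulr0 ler01.
by rewrite mulVf.
Qed.

Lemma normalize_eq0 v : normalize v = 0 -> v = 0.
Proof.
have [v0 _|v0] := eqVneq (cvnorm2 v) 0; first exact: cvnorm2_eq0.
move=> /eqP; rewrite scaler_eq0 => /orP[|/eqP //].
move=> /eqP/(congr1 (@complex.Re R))/= /eqP; rewrite invr_eq0 sqrtr_eq0 => h.
by move: v0; rewrite eq_le h cvnorm2_ge0.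
Qed.

Lemma rank1_normalize v : rank1 (normalize v) = ((cvnorm2 v)^-1)%:C *: rank1 v.
Proof.
apply: eq_mulmx_cV => w; rewrite -scalemxAl !rank1E /normalize cvdotZr !scalerA.
congr (_ *: _).
rewrite conj_realc.
have -> : (cvnorm2 v)^-1 = (Num.sqrt (cvnorm2 v))^-1 * (Num.sqrt (cvnorm2 v))^-1.
  by rewrite -invfM -expr2 sqr_sqrtr // cvnorm2_ge0.
by rewrite rmorphM mulrAC.
Qed.

Fixpoint deflations n P := if n is k.+1 then
  deflate (deflations k P) (first_col (deflations k P)) else P.

Definition proj_basis n P := normalize (first_col (deflations n P)).

Lemma deflationsE n P :
  deflations n P = P - \sum_(j < n) rank1 (proj_basis j P).
Proof.
elim: n => [|n IH] /=; first by rewrite big_ord0 subr0.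
by rewrite big_ord_recr /= opprD addrA -IH /proj_basis rank1_normalize.
Qed.

Lemma deflations_orthoprojmx n P : orthoprojmx P ->
  orthoprojmx (deflations n P) /\ P *m deflations n P = deflations n P.
Proof.
move=> oP; elim: n => [|n [oD eD]] /=; first by split => //; case: oP.
have v1 := mulmx_first_col oD.1.
split; first exact: orthoprojmx_deflate.
by apply: mulmx_deflatel => //; rewrite -v1 mulmxA eD.
Qed.

Lemma mulmx_proj_basis n P : orthoprojmx P -> P *m proj_basis n P = proj_basis n P.
Proof.
move=> oP; have [oD eD] := deflations_orthoprojmx n oP.
rewrite /proj_basis /normalize -scalemxAr; congr (_ *: _).
by rewrite -(mulmx_first_col oD.1) mulmxA eD.
Qed.

(** Each step lowers the trace by exactly 1 until the matrix becomes 0, where it stays; a projection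
    of trace at most 0 is 0 anyway. *)
Lemma deflations_eq0 n P : orthoprojmx P -> complex.Re (\tr P) <= n%:R ->
  deflations n P = 0.
Proof.
move=> oP trP; have K k : deflations k P = 0 \/
    complex.Re (\tr (deflations k P)) <= complex.Re (\tr P) - k%:R.
  elim: k => [|k [IH|IH]] /=; first by right; rewrite subr0.
    by left; rewrite IH first_col0 deflate0.
  have [/first_col_eq0 k0|k0] := eqVneq (first_col (deflations k P)) 0.
    by left; rewrite k0 first_col0 deflate0.
  right; rewrite mxtrace_deflate // cReD cReN /= -[k.+1]addn1 natrD; lra.
have [oD _] := deflations_orthoprojmx n oP.
by case: (K n) => // h; apply: mxtrace_orthoprojmx_eq0 => //; lra.
Qed.

Lemma orthoprojmx_proj_basis n P : orthoprojmx P -> complex.Re (\tr P) <= n%:R ->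
  P = \sum_(j < n) rank1 (proj_basis j P).
Proof.
move=> oP trP; apply/eqP; rewrite -subr_eq0 -deflationsE.
by rewrite deflations_eq0.
Qed.

(** Each vector is first projected by the current matrix [Q], because [orthoprojmx_deflate] requires
    a vector of the range. *)
Definition annihilate P (s : seq 'cV[C]_m) :=
  foldl (fun Q g => deflate Q (Q *m g)) P s.

(** The fourth clause carries the induction: later deflations do not revive a vector already killed.
    The trace bound is an inequality because a vector with [Q *m g = 0] costs nothing. *)
Lemma annihilateP P s : orthoprojmx P ->
  [/\ orthoprojmx (annihilate P s), P *m annihilate P s = annihilate P s,
      forall g : 'cV[C]_m, g \in s -> annihilate P s *m g = 0,
      forall g : 'cV[C]_m, P *m g = 0 -> annihilate P s *m g = 0 &
      complex.Re (\tr P) - (size s)%:R <= complex.Re (\tr (annihilate P s))].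
Proof.
rewrite /annihilate; elim: s P => [|v s IH] P oP /=.
  by split => //; [case: oP|rewrite subr0].
have [PP Psa] := oP; have PPv : P *m (P *m v) = P *m v by rewrite mulmxA PP.
have oQ := orthoprojmx_deflate oP PPv.
have [oD eD z1 n1 t1] := IH _ oQ.
have PQ : P *m deflate P (P *m v) = deflate P (P *m v) by exact: mulmx_deflatel.
split => //.
- by rewrite -eD mulmxA PQ.
- move=> g; rewrite inE => /orP[/eqP ->|]; last exact: z1.
  by apply: n1; exact: mulmx_deflate.
- by move=> g Pg; apply: n1; exact: mulmx_deflate0.
- have := mxtrace_deflate_ge P (P *m v); rewrite -[(size s).+1]addn1 natrD; lra.
Qed.

(** The columns of [B] are a basis of the kernel of [T], which is the range of [P], and [D] holds
    the coordinates of the columns of [P]. Thus [P = B *m D], while [P *m B = B] and linear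
    independence give [D *m B = 1%:M]; the two products have the same trace. *)
Lemma mxtrace_dim_ker (T : 'M[C]_m) : orthoprojmx T ->
  complex.Re (\tr (1%:M - T)) = (dim_ker T)%:R.
Proof.
move=> [TT _]; set P := 1%:M - T.
pose U := lker (linfun (mulmx T : 'cV[C]_m -> 'cV[C]_m)).
have UE v : (v \in U) = (T *m v == 0) by rewrite memv_ker lfunE.
pose r := \dim U; pose X := vbasis U.
pose B : 'M[C]_(m, r) := \matrix_(i, j) (X`_j : 'cV[C]_m) i ord0.
pose D : 'M[C]_(r, m) := \matrix_(j, i) coord X j (col i P).
have PU i : col i P \in U by rewrite UE colE mulmxA /P mulmxBr mulmx1 TT subrr mul0mx.
have BE (x : 'cV[C]_r) : B *m x = \sum_j x j ord0 *: X`_j.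
  apply/colP => i; rewrite !mxE summxE; apply: eq_bigr => j _.
  by rewrite !mxE mulrC.
have PBD : P = B *m D.
  apply/matrixP => i j; have /colP/(_ i) : col j P = B *m col j D.
    rewrite BE [LHS](coord_vbasis (PU j)); apply: eq_bigr => k _.
    by rewrite !mxE.
  by rewrite !mxE => ->; apply: eq_bigr => k _; rewrite !mxE.
have PB : P *m B = B.
  apply/matrixP => i j; have XU : X`_j \in U by apply: vbasis_mem; rewrite mem_nth ?size_tuple.
  have /colP/(_ i) : P *m X`_j = X`_j.
    by move: XU; rewrite UE /P mulmxBl mul1mx => /eqP ->; rewrite subr0.
  by rewrite !mxE => <-; apply: eq_bigr => k _; rewrite !mxE.
have DB : D *m B = 1%:M.
  apply/matrixP => a b.
  have h : B *m (col b (D *m B - 1%:M)) = 0.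
    by rewrite colE mulmxA mulmxBr mulmx1 mulmxA -PBD PB subrr mul0mx.
  have /freeP/(_ (fun k => (col b (D *m B - 1%:M)) k ord0)) := basis_free (vbasisP U).
  rewrite -BE h => /(_ erefl a); rewrite !mxE => /eqP; rewrite subr_eq0 => /eqP <- //.
by rewrite PBD mxtrace_mulC DB mxtrace1 (_ : complex.Re _ = r%:R) // -(rmorph_nat (real_complex R)).
Qed.

End OrthogonalProjections.

(** * Measurable dependence on the point of the circle *)

Section MeasurableProjections.
Variables (R : realType) (m : nat).
Local Notation C := R[i].
Local Notation mu := (circle_measure R).
Implicit Types (f g : circle R -> 'cV[C]_m) (P Q : circle R -> 'M[C]_m).

Definition mxmeasurable P := forall i j, cmeasurable (fun z => P z i j).

Lemma mxmeasurable_col P i : mxmeasurable P -> cvmeasurable (fun z => col i (P z)).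
Proof. by move=> mP j; under eq_fun do rewrite mxE. Qed.

Lemma mxmeasurable_mul P f : mxmeasurable P -> cvmeasurable f ->
  cvmeasurable (fun z => P z *m f z).
Proof.
move=> mP mf i; under eq_fun do rewrite mxE; apply: cmeasurable_sum => j.
exact: cmeasurableM.
Qed.

Lemma mxmeasurable_deflate P f : mxmeasurable P -> cvmeasurable f ->
  mxmeasurable (fun z => deflate (P z) (f z)).
Proof.
move=> mP mf i j; under eq_fun do rewrite !mxE.
apply: cmeasurableB => //; apply: cmeasurableM.
  by apply: cmeasurable_realc; apply: measurable_funV; exact: measurable_cvnorm2.
by apply: cmeasurableM => //; exact: cmeasurableJ.
Qed.

Lemma cvmeasurable_if (b : circle R -> bool) f g : measurable_fun setT b ->
  cvmeasurable f -> cvmeasurable g -> cvmeasurable (fun z => if b z then f z else g z).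
Proof.
move=> mb mf mg i; have [f1 f2] := mf i; have [g1 g2] := mg i; split.
  rewrite (_ : (fun z => _) = (fun z => if b z then complex.Re (f z i ord0)
     else complex.Re (g z i ord0))); first exact: measurable_fun_ifT.
  by apply/funext => z; case: (b z).
rewrite (_ : (fun z => _) = (fun z => if b z then complex.Im (f z i ord0)
   else complex.Im (g z i ord0))); first exact: measurable_fun_ifT.
by apply/funext => z; case: (b z).
Qed.

Lemma cvmeasurable_first_col P : mxmeasurable P ->
  cvmeasurable (fun z => first_col (P z)).
Proof.
move=> mP; rewrite /first_col; elim: (enum _) => [|i s IH] /=.
  by move=> j; under eq_fun do rewrite mxE; exact: cmeasurable_cst.
apply: cvmeasurable_if => //; last exact: mxmeasurable_col.
apply: measurable_fun_ltr; first exact: measurable_cst.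
by apply: measurable_cvnorm2; exact: mxmeasurable_col.
Qed.

Lemma cvmeasurable_normalize f : cvmeasurable f ->
  cvmeasurable (fun z => normalize (f z)).
Proof.
move=> mf i; under eq_fun do rewrite mxE; apply: cmeasurableM => //.
apply: cmeasurable_realc; apply: measurable_funV.
apply: measurableT_comp (measurable_cvnorm2 mf).
by apply: continuous_measurable_fun; exact: sqrt_continuous.
Qed.

Lemma mxmeasurable_deflations P n : mxmeasurable P ->
  mxmeasurable (fun z => deflations n (P z)).
Proof.
move=> mP; elim: n => //= n IH.
by apply: mxmeasurable_deflate => //; exact: cvmeasurable_first_col.
Qed.

Lemma mxmeasurable_annihilate P (s : seq (circle R -> 'cV[C]_m)) : mxmeasurable P ->
  (forall g, g \in s -> cvmeasurable g) ->
  mxmeasurable (fun z => annihilate (P z) [seq g z | g <- s]).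
Proof.
rewrite /annihilate; elim: s P => //= g s IH P mP ms; apply: IH.
  apply: mxmeasurable_deflate => //; apply: mxmeasurable_mul => //.
  by apply: ms; rewrite mem_head.
by move=> h hs; apply: ms; rewrite inE hs orbT.
Qed.

Lemma L2_normalize f : cvmeasurable f -> L2 (fun z => normalize (f z)).
Proof.
move=> mf; apply: (@L2_bd _ _ _ 1); first exact: cvmeasurable_normalize.
by move=> z; exact: cvnorm2_normalize.
Qed.

End MeasurableProjections.

(** * Pointwise description of [M] and the two frame estimates *)

Section DoublyInvariant.
Variables (R : realType) (m : nat).
Local Notation C := R[i].
Local Notation mu := (circle_measure R).
Local Notation V := (circle R -> 'cV[C]_m).
Variables (M : set V) (Theta : circle R -> 'M[C]_m).
Hypothesis cM : closed_subspace L2 L2ip M.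
Hypothesis LT : Linfty_mx Theta.
Hypothesis oT : is_orthoproj L2 L2ip (orthocompl L2 L2ip M) (mulop Theta).
Implicit Types (f g h : V).

Let S := L2_sip R m.

Let ML2 f : M f -> L2 f.
Proof. by case: cM => + _ _ _; exact. Qed.

Let mT : mxmeasurable Theta.
Proof. by move=> i j; have [] := LT i j. Qed.

Let orthoK f : orthocompl L2 L2ip (orthocompl L2 L2ip M) f -> M f.
Proof. exact: (orthocomplK S (@L2_rapidly_complete R m) cM). Qed.

Let MB f g : M f -> M g -> M (f - g).
Proof.
move=> Mf Mg; rewrite -scaleN1r; apply: (closed_subspaceD cM) => //.
exact: (closed_subspaceZ _ cM).
Qed.

Let orthoM f : M f -> orthocompl L2 L2ip M f -> {ae mu, forall z, f z = 0}.
Proof.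
move=> Mf [Lf fM]; apply/hnorm_eq0 => //.
by apply/eqP; rewrite -sqrf_eq0 (hnormE S) // fM.
Qed.

Let M_sub_mulop f : L2 f -> M (f - mulop Theta f).
Proof. by move=> Lf; apply: orthoK; have [] := oT Lf. Qed.

Let ortho_mulop f : L2 f -> orthocompl L2 L2ip M (mulop Theta f).
Proof. by move=> Lf; have [] := oT Lf. Qed.

(** If [f] is in [M], then [mulop Theta f] lies both in [M] and in its orthocomplement, so it is
    null. Conversely [f] is at distance 0 from [f - mulop Theta f], which is in [M], and [M] is
    closed. *)
Lemma memME f : L2 f -> M f <-> {ae mu, forall z, Theta z *m f z = 0}.
Proof.
move=> Lf; split => [Mf|f0].
  apply: (@orthoM (mulop Theta f)); last exact: ortho_mulop.
  have -> : mulop Theta f = f - (f - mulop Theta f) by rewrite opprB addrC subrK.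
  by apply: MB => //; exact: M_sub_mulop.
have [_ _ _ cl] := cM; apply: cl => // e e0.
exists (f - mulop Theta f); first exact: M_sub_mulop.
rewrite opprB addrC subrK; suff -> : hnorm L2ip (mulop Theta f) = 0 by [].
by apply/hnorm_eq0 => //; have [] := ortho_mulop Lf.
Qed.

Lemma mulop_ortho f : orthocompl L2 L2ip M f ->
  {ae mu, forall z, Theta z *m f z = f z}.
Proof.
move=> oMf; have [Lf fM] := oMf; have [LTf TfM] := ortho_mulop Lf.
have : {ae mu, forall z, (f - mulop Theta f) z = 0}.
  apply: orthoM; first exact: M_sub_mulop.
  split; first exact: (sipB S).
  move=> g Mg; rewrite (ipBl S) ?fM ?TfM ?subrr //; exact: ML2.
by apply: filterS => z /eqP; rewrite -[_ == _]/(f z - Theta z *m f z == 0) subr_eq0 => /eqP.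
Qed.

Let cst_delta (i : 'I_m) : V := fun=> delta_mx i ord0.

Let L2_cst_delta i : L2 (cst_delta i).
Proof.
have := @L2_fourier_basis R m (0, i); congr L2; apply/funext => z.
by rewrite /fourier_basis expr0z scale1r.
Qed.

Let Theta_idem : {ae mu, forall z, Theta z *m Theta z = Theta z}.
Proof.
have : {ae mu, forall z (i : 'I_m), Theta z *m (Theta z *m delta_mx i ord0) =
    Theta z *m delta_mx i ord0 :> 'cV[C]_m}.
  apply: filter_forall => i.
  exact: (mulop_ortho (ortho_mulop (L2_cst_delta i))).
apply: filterS => z hz; apply/matrixP => a i.
by have /colP/(_ a) := hz i; rewrite mulmxA -!colE !mxE.
Qed.

Let L2_circleX f (n : int) : L2 f -> L2 (fun z => val z ^ n *: f z).
Proof.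
move=> /L2E[mf fi]; apply: (L2_dom _ fi) => [i|z].
  under eq_fun do rewrite mxE; apply: cmeasurableM => //; exact: cmeasurable_circleX.
by rewrite cvnorm2Z normc_circleX expr1n mul1r.
Qed.

(** The image of $z^ne_i$ lies in $M^\perp$ and $(1-\Theta)e_j$ lies in $M$. Their inner products,
    zero for every [n], are the Fourier coefficients of the scalar function in question. *)
Let Theta_ortho : {ae mu, forall z (i j : 'I_m),
  cvdot (Theta z *m delta_mx i ord0) (delta_mx j ord0 - Theta z *m delta_mx j ord0) = 0}.
Proof.
apply: filter_forall => i; apply: filter_forall => j.
have LTi := (ortho_mulop (L2_cst_delta i)).1.
have Mj := M_sub_mulop (L2_cst_delta j).
have Lj := ML2 Mj.
apply: null_fourier_ae0; split; first exact: (cintegrable_cvdot LTi Lj).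
move=> n; have [_ /(_ _ Mj) h] := ortho_mulop (L2_circleX n (L2_cst_delta i)).
rewrite -[RHS]h; congr cintegral; apply/funext => z.
rewrite -[RHS]/(cvdot (Theta z *m (val z ^ n *: delta_mx i ord0))
  (delta_mx j ord0 - Theta z *m delta_mx j ord0)).
by rewrite -scalemxAr cvdotZl mulrC.
Qed.

(** Sesquilinearity extends the relation from basis vectors to $\langle\Theta v,w-\Theta w\rangle=0$
    for all $v,w$, whence $\langle\Theta v,w\rangle=\langle\Theta v,\Theta w\rangle=\langle v,\Theta
    w\rangle$. *)
Lemma orthoprojmx_Theta : {ae mu, forall z, orthoprojmx (Theta z)}.
Proof.
apply: filterS2 Theta_idem Theta_ortho => z TT To; split => //.
have col_sum (v : 'cV[C]_m) : v = \sum_i v i ord0 *: delta_mx i ord0.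
  apply/colP => a; rewrite summxE (bigD1 a) //= big1 => [|i ia].
    by rewrite !mxE !eqxx mulr1 addr0.
  by rewrite !mxE eq_sym (negbTE ia) mulr0.
have K v w : cvdot (Theta z *m v) (w - Theta z *m w) = 0.
  have K1 i : cvdot (Theta z *m delta_mx i ord0) (w - Theta z *m w) = 0.
    have -> : w - Theta z *m w = \sum_j w j ord0 *: (delta_mx j ord0 - Theta z *m delta_mx j ord0).
      rewrite {1 2}(col_sum w) mulmx_sumr -sumrB; apply: eq_bigr => j _.
      by rewrite scalerBr scalemxAr.
    rewrite cvdotJ (ip_suml (cvdot_sip R m)) // big1 ?rmorph0 // => j _.
    by rewrite cvdotZl (cvdotJ _ (Theta z *m _)) To rmorph0 mulr0.
  rewrite {1}(col_sum v) mulmx_sumr (ip_suml (cvdot_sip R m)) // big1 // => i _.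
  by rewrite -scalemxAr cvdotZl K1 mulr0.
move=> v w; have := K v w; have := K w v; rewrite !cvdotBr.
move=> /eqP; rewrite subr_eq0 => /eqP h1 /eqP; rewrite subr_eq0 => /eqP ->.
by rewrite cvdotJ -h1 -cvdotJ.
Qed.

Lemma memM_circleX f (n : int) : M f -> M (fun z => val z ^ n *: f z).
Proof.
move=> Mf; have Lf := ML2 Mf; apply/memME; first exact: L2_circleX.
have /memME := Mf => /(_ Lf); apply: filterS => z f0.
by rewrite -scalemxAr f0 scaler0.
Qed.

(** For negative powers, [pinv_] inverts [mulz] only on the image of [M]; an element [g] of [M] is
    in this image because $z^{-1}g$ is again in [M]. *)
Lemma opow_mulz f (n : int) : M f -> opow M mulz n f = fun z => val z ^ n *: f z.
Proof.
move=> Mf; case: n => k /=.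
  elim: k => [|k IH] /=; first by apply/funext => z; rewrite expr0z scale1r.
  rewrite IH; apply/funext => z; rewrite /mulz scalerA.
  by congr (_ *: _); rewrite -!exprnP exprS.
have inj : {in M &, injective (@mulz R m)}.
  move=> g h _ _ gh; apply/funext => z; have := congr1 (@^~ z) gh.
  by apply: scalerI; exact: circle_neq0.
have pinv g : M g -> 'pinv_(fun=> 0) M (@mulz R m) g = fun z => val z ^ (-1) *: g z.
  move=> Mg; pose g' : V := fun z => val z ^ (-1) *: g z.
  have Mg' : M g' by exact: memM_circleX.
  have -> : g = mulz g'.
    apply/funext => z; rewrite /mulz /g' scalerA -[X in X * _]expr1z -expfzDr ?circle_neq0 //.
    by rewrite subrr expr0z scale1r.
  rewrite pinvKV ?inE //; apply/funext => z.
  rewrite /mulz scalerA -[X in _ * X]expr1z -expfzDr ?circle_neq0 //.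
  by rewrite addrC subrr expr0z scale1r.
rewrite -[LHS]/(iter k.+1 ('pinv_(fun=> 0) M (@mulz R m)) f).
elim: k => [|k IH]; first by rewrite /= pinv.
rewrite iterS IH pinv; last exact: memM_circleX.
apply/funext => z; rewrite scalerA -expfzDr ?circle_neq0 //.
Qed.

Lemma L2ip_opow f g n : M f -> M g ->
  L2ip f (opow M mulz n g) = cintegral (fun z => cvdot (f z) (g z) * val z ^ (- n)).
Proof.
move=> Mf Mg; rewrite opow_mulz //.
rewrite -[LHS]/(cintegral (fun z => cvdot (f z) (val z ^ n *: g z))).
congr cintegral; apply/funext => z; rewrite cvdotZr mulrC; congr (_ * _).
exact: circle_conjX.
Qed.

Let P z := 1%:M - Theta z.

Let mP : mxmeasurable P.
Proof.
move=> i j; rewrite /P; under eq_fun do rewrite mxE [X in _ + X]mxE.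
by apply: cmeasurableB => //; exact: cmeasurable_cst.
Qed.

Let oP : {ae mu, forall z, orthoprojmx (P z)}.
Proof. by apply: filterS orthoprojmx_Theta => z; exact: orthoprojmx_compl. Qed.

Let Theta_fix z (v : 'cV[C]_m) : P z *m v = v -> Theta z *m v = 0.
Proof.
rewrite /P mulmxBl mul1mx => /eqP; rewrite subr_eq addrC -subr_eq subrr eq_sym.
by move/eqP.
Qed.

(** The same [k] fields serve at every point: where the trace of $P(z)$ is below [k], the surplus
    fields are 0 and do not affect the sum. *)
Lemma frame_of_dim_ker k : {ae mu, forall z, (dim_ker (Theta z) <= k)%N} ->
  exists g : 'I_k -> V, (forall j, M (g j)) /\
    is_frame L2ip M (bilateral_orbits M mulz g).
Proof.
move=> dk; pose w (j : 'I_k) : V := fun z => proj_basis j (P z).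
have mw j : cvmeasurable (w j).
  apply: cvmeasurable_normalize; apply: cvmeasurable_first_col.
  exact: mxmeasurable_deflations.
have Lw j : L2 (w j).
  by apply: L2_normalize; apply: cvmeasurable_first_col; exact: mxmeasurable_deflations.
have Mw j : M (w j).
  apply/memME => //; apply: filterS oP => z oPz; apply: Theta_fix.
  exact: mulmx_proj_basis.
have Psum : {ae mu, forall z, P z = \sum_(j < k) rank1 (w j z)}.
  apply: filterS2 orthoprojmx_Theta dk => z oTz dz.
  apply: orthoprojmx_proj_basis; first exact: orthoprojmx_compl.
  by rewrite mxtrace_dim_ker // ler_nat.
exists w; split => //; split.
  move=> [n j]; rewrite /bilateral_orbits /= opow_mulz //; exact: memM_circleX.
exists 1, 1; split => // h Mh; have Lh := ML2 Mh.
pose f : circle R -> 'cV[C]_k := fun z => \col_j cvdot (h z) (w j z).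
have fE z j : f z j ord0 = cvdot (h z) (w j z) by rewrite mxE.
have Lf : L2 f.
  have [mh hi] := (L2E h).1 Lh.
  apply: (@L2_dom _ _ _ (fun z => k%:R * cvnorm2 (h z))).
  - by move=> j; under eq_fun do rewrite fE; exact: cmeasurable_cvdot.
  - exact: integrable_realZ.
  - move=> z; have -> : k%:R * cvnorm2 (h z) = \sum_(j < k) cvnorm2 (h z).
      by rewrite sumr_const card_ord mulr_natl.
    apply: ler_sum => j _; rewrite fE; apply: le_trans (cvdot_cs _ _) _.
    by rewrite ler_piMr ?cvnorm2_ge0 ?cvnorm2_normalize.
(* Since $Ph=h$ and $P$ is the sum of the rank-one matrices of the $w_j$, $\|h\|^2=\langle
   Ph,h\rangle=\sum_j|\langle h,w_j\rangle|^2$ pointwise. *)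
have fh : {ae mu, forall z, cvnorm2 (f z) = cvnorm2 (h z)}.
  have h0 := (memME Lh).1 Mh.
  apply: filterS2 Psum h0 => z Pz hz.
  have Ph : P z *m h z = h z by rewrite /P mulmxBl mul1mx hz subr0.
  rewrite [RHS]cvnorm2E -{1}Ph Pz mulmx_suml (ip_suml (cvdot_sip R m)) //.
  rewrite cRe_sum; apply: eq_bigr => j _; rewrite fE rank1E cvdotZl.
  by rewrite (cvdotJ (w j z)) normc_sqr !ReImE; ring.
have hf : hnorm L2ip h ^+ 2 = hnorm L2ip f ^+ 2.
  have [mh hi] := (L2E h).1 Lh; have [mf fi] := (L2E f).1 Lf.
  rewrite !L2_hnorm_sqr // /Rintegral; congr fine; apply: ae_eq_integral => //.
  - by apply/measurable_EFinP; exact: measurable_cvnorm2.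
  - by apply/measurable_EFinP; exact: measurable_cvnorm2.
  - by apply: filterS fh => z -> _.
have -> : (\esum_(i in [set: int * 'I_k])
    (Normc.normc (L2ip h (bilateral_orbits M mulz w i)) ^+ 2)%:E =
    (hnorm L2ip h ^+ 2)%:E)%E.
  rewrite hf -(fourier_parseval Lf); apply: eq_esum => -[n j] _.
  congr ((Normc.normc _ ^+ 2)%:E).
  rewrite L2ip_opow // L2ip_fourier_basis; congr cintegral.
  by apply/funext => z; rewrite fE.
by rewrite !mul1r lexx.
Qed.

Lemma frame_dim_ker (J : countType) (g : J -> V) (s : seq J) :
  (forall j, M (g j)) -> is_frame L2ip M (bilateral_orbits M mulz g) ->
  (forall j, j \in s) -> {ae mu, forall z, (dim_ker (Theta z) <= size s)%N}.
Proof.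
move=> Mg [_ [A [B [A0 B0 AB]]]] sJ.
pose Q z := annihilate (P z) [seq f z | f <- [seq g j | j <- s]].
have mQ : mxmeasurable Q.
  apply: mxmeasurable_annihilate => // f /mapP[j _ ->].
  exact: (L2_cvmeasurable (ML2 (Mg j))).
have aQ : {ae mu, forall z, [/\ orthoprojmx (Q z), P z *m Q z = Q z,
    forall j, Q z *m g j z = 0 &
    complex.Re (\tr (P z)) - (size s)%:R <= complex.Re (\tr (Q z))]}.
  apply: filterS oP => z oPz.
  have [q1 q2 q3 _ q4] := annihilateP [seq f z | f <- [seq g j | j <- s]] oPz.
  split => //; last by move: q4; rewrite !size_map.
  by move=> j; apply: q3; apply/mapP; exists (g j) => //; apply/mapP; exists j.
(* Normalizing bounds the columns at every point, hence makes them square integrable, without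
   changing where they vanish. *)
pose h i : V := fun z => normalize (col i (Q z)).
have Lh i : L2 (h i) by apply: L2_normalize; exact: mxmeasurable_col.
have Mh i : M (h i).
  apply/memME => //; apply: filterS aQ => z [_ PQ _ _]; apply: Theta_fix.
  by rewrite /h /normalize -scalemxAr colE mulmxA PQ.
have h0 i : {ae mu, forall z, h i z = 0}.
  apply/hnorm_eq0 => //.
  have /andP[+ _] := AB _ (Mh i).
  rewrite (_ : esum _ _ = 0%E); last first.
    apply: esum1 => -[n j] _.
    (* A.e. $\langle Qe_i,g_j\rangle=\langle e_i,Qg_j\rangle=0$, so the integrand vanishes whatever
       the power of $z$. *)
    have gj0 : L2ip (h i) (bilateral_orbits M mulz g (n, j)) = 0.
      rewrite L2ip_opow // -[RHS](@cintegral0 R).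
      apply: ae_eq_cintegral.
      - apply: cmeasurableM; last exact: cmeasurable_circleX.
        by apply: cmeasurable_cvdot; exact: L2_cvmeasurable (ML2 _).
      - exact: cmeasurable_cst.
      - apply: filterS aQ => z [[_ Qsa] _ Qg _].
        rewrite /h /normalize cvdotZl colE Qsa Qg ?cvdot0r ?mulr0 ?mul0r //.
    by rewrite gj0 Normc.normc0 expr0n.
  rewrite lee_fin => le0; apply/eqP; rewrite -sqrf_eq0 eq_le sqr_ge0 andbT.
  by rewrite -(pmulr_rle0 _ A0).
have : {ae mu, forall z i, h i z = 0} by apply: filter_forall.
move=> h00; apply: filterS3 orthoprojmx_Theta aQ h00 => z oTz [_ _ _ trQ] hz.
have Q0 : Q z = 0 by apply: col_eq0 => i; apply: normalize_eq0; exact: hz.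
move: trQ; rewrite Q0 raddf0 mxtrace_dim_ker // subr_le0 ler_nat //.
Qed.

End DoublyInvariant.

Theorem theorem3p5 (R : realType) (m : nat)
    (M : set (circle R -> 'cV[R[i]]_m)) (Theta : circle R -> 'M[R[i]]_m) :
  doubly_invariant L2 L2ip mulz M ->
  (exists2 f, M f & hnorm L2ip f != 0) ->
  Linfty_mx Theta ->
  is_orthoproj L2 L2ip (orthocompl L2 L2ip M) (mulop Theta) ->
  bilateral_frame_number L2ip M mulz =
    ess_sup (circle_measure R) (fun z => ((dim_ker (Theta z))%:R)%:E).
Proof.
move=> [cM _ _] _ LT oT; pose mu := circle_measure R.
pose d z := dim_ker (Theta z); pose bound k := {ae mu, forall z, (d z <= k)%N}.
have bm : bound m.
  apply: aeW => z; rewrite /d /dim_ker; apply: leq_trans (dimvS (subvf _)) _.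
  by rewrite dimvf /dim /= muln1.
(* The least natural number that bounds the dimension a.e.; it will turn out to be the essential
   supremum. *)
have [k bk kmin] : exists2 k, bound k & forall n, bound n -> (k <= n)%N.
  have ex : exists k, `[< bound k >] by exists m; apply/asboolP.
  case: (ex_minnP ex) => k /asboolP bk kmin; exists k => // n bn.
  by apply: kmin; apply/asboolP.
have mu1 : (0 < (mu : {measure set _ -> \bar R}) setT)%E.
  by rewrite [X in (0 < X)%E]circle_measureT lte_fin.
apply/eqP; rewrite eq_le; apply/andP; split; last first.
  apply: le_ereal_inf_tmp => _ [J [g [Mg fr ->]]].
  (* Infinitely many generators count as [+oo], where the bound is trivial. *)
  rewrite /counting; case: asboolP => [fJ|_]; last exact: leey.
  apply/ess_supP; pose s := enum_fset (fset_set [set: J]).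
  have sJ j : j \in s.
    by have : j \in fset_set [set: J] by rewrite in_fset_set ?inE.
  apply: filterS (frame_dim_ker cM LT oT Mg fr sJ) => z dz.
  by rewrite lee_fin ler_nat.
apply: (@le_trans _ _ (k%:R%:E)).
  have [g [Mg fr]] := frame_of_dim_ker cM LT oT bk.
  apply: (@le_trans _ _ (counting [set: 'I_k])).
    by apply: ereal_inf_lbound; exists 'I_k, g.
  rewrite /counting asboolT; last exact: finite_finset.
  rewrite lee_fin ler_nat -[leqRHS](size_enum_ord k).
  by apply: uniq_leq_size => [|j _]; rewrite ?fset_uniq ?mem_enum.
(* For [k = 0] it is enough that a nonnegative function on a space of positive mass has nonnegative
   essential supremum. *)
case: k bk kmin => [|k] bk kmin.
  by apply: ess_sup_ger => // z; rewrite lee_fin ler0n.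
(* The dimension is an integer, so an essential supremum below [k.+1] would make [k] an a.e. bound,
   against minimality. *)
rewrite leNgt; apply/negP => lt.
have : bound k; last by move/kmin; rewrite ltnn.
have := ess_sup_ge mu (fun z => (d z)%:R%:E).
apply: filterS => z /le_lt_trans/(_ lt); rewrite lte_fin ltr_nat ltnS //.
Qed.
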